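(* Let $k$ be a positive integer, let $G$ be a balanced bipartite graph of order $2n$ with partite sets $X$ and $Y$, and let $M$ be a perfect matching of $G$, where $n \ge 12k+3$. If $\sigma_{1,1}(G) \ge n+2$, then $G$ has a $2$-factor consisting of exactly $k$ cycles, each of length at least $6$, which contains every edge of $M$.
   Context: Graphs are finite and simple. For a bipartite graph $G$ with partite sets $X,Y$, $\sigma_{1,1}(G) = \min\{d_G(x)+d_G(y) : x \in X,\ y \in Y,\ xy \notin E(G)\}$ if $G$ is not complete bipartite, and $\sigma_{1,1}(G)=+\infty$ otherwise. A $2$-factor is a spanning subgraph in which every component is a cycle. *)

(* Defs.v *)
From mathcomp Require Import all_boot.
Set Implicit Arguments. Unset Strict Implicit. Unset Printing Implicit Defensive.

Definition simple_graph (T : finType) (e : rel T) : Prop :=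
  symmetric e /\ irreflexive e.

Definition bipartite_with (T : finType) (e : rel T) (X : {set T}) : Prop :=
  forall x y, e x y -> (x \in X) != (y \in X).

Definition edges (T : finType) (e : rel T) : {set {set T}} :=
  [set [set x; y] | x in T, y in T & e x y].

Definition deg (T : finType) (e : rel T) (v : T) : nat := #|[set y | e v y]|.

Definition edeg (T : finType) (F : {set {set T}}) (v : T) : nat :=
  #|[set f in F | v \in f]|.

Definition perfect_matching (T : finType) (e : rel T) (M : {set {set T}}) : Prop :=
  M \subset edges e /\ forall v, edeg M v = 1.

(* sigma_{1,1}(G) >= s (vacuous when G is complete bipartite, sigma = +oo). *)
Definition sigma11_ge (T : finType) (e : rel T) (X : {set T}) (s : nat) : Prop :=
  forall x y, x \in X -> y \notin X -> ~~ e x y -> s <= deg e x + deg e y.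

Definition frel (T : finType) (F : {set {set T}}) : rel T :=
  fun x y => [set x; y] \in F.

Definition fcomp (T : finType) (F : {set {set T}}) (x : T) : {set T} :=
  [set y | connect (frel F) x y].

(* A 2-factor: a spanning 2-regular subgraph (each component is a cycle). *)
Definition two_factor (T : finType) (e : rel T) (F : {set {set T}}) : Prop :=
  F \subset edges e /\ forall v, edeg F v = 2.

Definition ncycles (T : finType) (F : {set {set T}}) : nat :=
  #|[set fcomp F x | x : T]|.

(* Main.v *)
(** Contracting the edges of [M] turns [G] into a digraph on [X] in which nonadjacent
    [u, v] satisfy [d^+(u) + d^-(v) >= n], and the required 2-factors correspond to
    partitions of the digraph into [k] cycles of length at least 3.  The vertices of
    total degree less than [n], together with those adjacent to all others, are
    pairwise adjacent.  Since [n >= 12k+3], there are [k] disjoint cycles of length 3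
    or 4, and they can be rerouted to cover this semicomplete set.  A family of [k]
    cycles that covers it and is as large as possible is spanning: the uncovered
    vertices have degree at least [n], so they induce a strongly connected digraph,
    every cycle of the family has arcs only to it or only from it, at most four
    vertices are uncovered, they lie on one common cycle, and the degrees around a
    longest cycle of the family then contradict the degree condition. *)

Require Import Defs.
From mathcomp Require Import all_boot zify.
From Stdlib Require Import Classical.
Set Implicit Arguments. Unset Strict Implicit. Unset Printing Implicit Defensive.

(** * Longest paths *)

(** A cycle of length m in the digraph lifts to a cycle of length 2m that alternates between
    matching edges and lifted arcs, so length at least 6 means that digons are forbidden. This is
    the main obstacle: strong connectivity by itself only yields cycles of length at least 2, and
    most special cases below dispose of digons. It is also the reason for covering in advance the
    vertices adjacent to all others: otherwise exactly two vertices, forming a digon, could stay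
    uncovered. The [n + 2] becomes [n] because the matching edge at either end of a nonadjacent pair
    disappears in the contraction. The coefficient 12 is 4 + 3 + 5. To pass from t to t + 1 short
    cycles, at most 4t vertices lie on the given cycles, at most 3t in partial cycles set aside, and
    the rest must exceed 5(t + 1) for a local degree count. One such step assumes 12t + 15 vertices,
    which is 12(t + 1) + 3. Every exchange preserves the number of cycles: when two cycles are
    merged into one, a cycle among the free vertices replaces the lost one. *)

Lemma ex_max_measure (A : Type) (P : A -> Prop) (f : A -> nat) b a0 :
  P a0 -> (forall a, P a -> f a <= b) ->
  exists2 a, P a & forall a', P a' -> f a' <= f a.
Proof.
move=> Pa0 bnd; have [m le_m] := ubnP (b - f a0).
elim: m => // m IHm in a0 Pa0 le_m *.
(* Excluded middle replaces a search, as [A] need not be finite. *)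
have [[a' [Pa' lt_a']]|nex] := classic (exists a', P a' /\ f a0 < f a').
  by apply: (IHm a') => //; have := bnd _ Pa'; lia.
by exists a0 => // a' Pa'; rewrite leqNgt; apply/negP => lt_a; apply: nex; exists a'.
Qed.

Section Digraph.
Variables (V : finType) (r : rel V).
Implicit Types (c p q : seq V) (S : {set V}) (u v w x y : V).

(** Digons are excluded because they would lift to cycles of length 4. *)
Definition dcyc c := [&& cycle r c, uniq c & 2 < size c].

Lemma dcyc_uniq c : dcyc c -> uniq c. Proof. by case/and3P. Qed.

Lemma size_uniq_le c : uniq c -> size c <= #|V|.
Proof. by move/card_uniqP <-; apply: max_card. Qed.

(** Digons inside [S] are still allowed. *)
Definition acyc S := forall c, dcyc c -> ~ {subset c <= S}.

Hypothesis irr : irreflexive r.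

(** An out-neighbour of the last vertex off the path would lengthen it, and one before the
    penultimate vertex would close a cycle of length at least 3. Only the penultimate vertex is
    left. *)
Lemma last_out S x p : acyc S -> path r x p -> uniq (x :: p) ->
    {subset x :: p <= S} ->
    (forall y q, path r y q -> uniq (y :: q) -> {subset y :: q <= S} -> size q <= size p) ->
  forall w, w \in S -> r (last x p) w -> index w (x :: p) = (size p).-1 /\ w \in x :: p.
Proof.
move=> acS pth up sub maxp w wS rw.
have w_in : w \in x :: p.
  apply: contraT => w_out.
  have := maxp x (rcons p w); rewrite rcons_path pth rw size_rcons ltnn.
  apply=> //; first by rewrite -rcons_cons rcons_uniq w_out.
  by move=> z; rewrite -rcons_cons mem_rcons inE => /orP[/eqP->//|/sub].
split=> //; clear maxp; move: pth up sub rw.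
case/splitPl: w_in => p1 p2 lst; rewrite cat_path last_cat lst => /andP[_ pth2].
rewrite -cat_cons cat_uniq => /and3P[u1 disj u2] sub rw.
case: p2 => [|w1 p2] in pth2 disj u2 sub rw *; first by rewrite /= irr in rw.
have ix : index w (x :: p1) = size p1.
  by rewrite -lst -[last x p1](nth_last x (x :: p1)) index_uniq.
rewrite index_cat ix size_cat /= addnS.
have -> : w \in x :: p1 by rewrite -lst mem_last.
case: p2 => [|w2 p2] in pth2 disj u2 sub rw *; first by rewrite addn0.
case: (acS [:: w, w1, w2 & p2]); last first.
  move=> z zin; apply: sub; rewrite mem_cat; move: zin; rewrite inE => /orP[/eqP->|->].
    by rewrite -lst mem_last.
  by rewrite orbT.
rewrite /dcyc /= rcons_path; move: pth2; rewrite /= => /and3P[-> -> ->] /=.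
move: rw => /= -> /=; rewrite andbT; apply/andP; split; last by [].
by apply: contra disj => w_in; apply/hasP; exists w; rewrite // -lst mem_last.
Qed.

Lemma card_sub1 (A : {set V}) a : (forall w, w \in A -> w = a) -> #|A| <= 1.
Proof.
move=> h; rewrite -(cards1 a); apply: subset_leq_card.
by apply/subsetP => w /h ->; rewrite inE.
Qed.

Lemma card_last_out S x p : acyc S -> path r x p -> uniq (x :: p) ->
    {subset x :: p <= S} ->
    (forall y q, path r y q -> uniq (y :: q) -> {subset y :: q <= S} -> size q <= size p) ->
  #|[set w in S | r (last x p) w]| <= 1.
Proof.
move=> acS pth up sub maxp; apply: (@card_sub1 _ (nth x (x :: p) (size p).-1)) => w.
rewrite inE => /andP[wS rw].
have [<- w_in] := last_out acS pth up sub maxp wS rw.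
by rewrite nth_index.
Qed.
End Digraph.

Section Rev.
Variables (V : finType) (r : rel V).
(** Arc reversal, which turns each statement on out-arcs into one on in-arcs. *)
Definition conv : rel V := fun x y => r y x.
Lemma dcyc_rev c : dcyc conv (rev c) = dcyc r c.
Proof. by rewrite /dcyc rev_cycle rev_uniq size_rev. Qed.
Lemma acyc_conv S : acyc r S -> acyc conv S.
Proof.
move=> acS c dc sub; apply: (acS (rev c)).
  by move: dc; rewrite -{1}(revK c) dcyc_rev.
by move=> z; rewrite mem_rev; apply: sub.
Qed.
End Rev.

Section LowDegreePair.
Variables (V : finType) (r : rel V).
Implicit Types (c p q : seq V) (S : {set V}) (u v w x y : V).
Hypothesis irr : irreflexive r.

Lemma card_first_in S x p : acyc r S -> path r x p -> uniq (x :: p) ->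
    {subset x :: p <= S} ->
    (forall y q, path r y q -> uniq (y :: q) -> {subset y :: q <= S} -> size q <= size p) ->
  #|[set w in S | r w x]| <= 1.
Proof.
move=> acS pth up sub maxp.
have e : x = last (last x p) (rev (belast x p)).
  by case: p {pth up sub maxp} => //= y p; rewrite rev_cons last_rcons.
have -> : [set w in S | r w x] = [set w in S | conv r (last (last x p) (rev (belast x p))) w] by rewrite -e.
have ee : last x p :: rev (belast x p) = rev (x :: p).
  by rewrite [x :: p]lastI rev_rcons.
have irr' : irreflexive (conv r) by move=> z; apply: irr.
apply: (@card_last_out V (conv r) irr' S (last x p) (rev (belast x p))).
- exact: acyc_conv.
- by rewrite rev_path.
- by rewrite ee rev_uniq.
- by move=> z; rewrite ee mem_rev; apply: sub.
move=> y q pq uq sq; rewrite size_rev size_belast.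
have := maxp (last y q) (rev (belast y q)).
rewrite size_rev size_belast; apply.
- by rewrite rev_path.
- by rewrite -rev_rcons rev_uniq -lastI.
- by move=> z; rewrite -rev_rcons mem_rev -lastI; apply: sq.
Qed.

(** The two ends of a longest path: an arc from its last to its first vertex would close a cycle
    once there are three vertices. Such a pair violates the degree condition when little lies
    outside [S], which is how cycles are found inside large sets. *)
Lemma acyc_low_degree_pair S : acyc r S -> 2 < #|S| ->
  exists x y, [/\ x \in S, y \in S, x != y, ~~ r x y
    & #|[set w in S | r x w]| <= 1 /\ #|[set w in S | r w y]| <= 1].
Proof.
move=> acS gt2.
have [x0 x0S] : exists x, x \in S by apply/set0Pn; rewrite -card_gt0; lia.
pose P (a : V * seq V) := [/\ path r a.1 a.2, uniq (a.1 :: a.2) & {subset a.1 :: a.2 <= S}].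
have [||[x p] [pth up sub] maxp0] := @ex_max_measure (V * seq V) P (fun a => size a.2) #|V| (x0, [::]).
- by split=> // z; rewrite inE => /eqP->.
- by move=> [a b] [_ /size_uniq_le /= h _]; apply: ltnW.
rewrite /= in pth up sub maxp0.
have maxp y q : path r y q -> uniq (y :: q) -> {subset y :: q <= S} -> size q <= size p.
  by move=> h1 h2 h3; apply: (maxp0 (y, q)).
have E2 y q : path r y q -> uniq (y :: q) -> {subset y :: q <= S} -> size q = size p ->
    #|[set w in S | r (last y q) w]| <= 1 /\ #|[set w in S | r w y]| <= 1.
  move=> h1 h2 h3 h4; have mx := maxp; rewrite -h4 in mx.
  by split; [apply: card_last_out | apply: card_first_in h1 h2 h3 mx].
have xS : x \in S by apply: sub; rewrite mem_head.
have lS : last x p \in S by apply: sub; rewrite mem_last.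
have out_idx := last_out irr acS pth up sub maxp.
have [d1 d2] := E2 x p pth up sub erefl.
have out3 : exists w, [/\ w \in S, w != x & w != last x p].
  have : 0 < #|S :\: [set x; last x p]|.
    by rewrite cardsD; have := subset_leq_card (subsetIr S [set x; last x p]);
       rewrite cards2; lia.
  rewrite card_gt0 => /set0Pn[w]; rewrite !inE negb_or => /andP[/andP[? ?] ?].
  by exists w.
case: p => [|y1 [|y2 p]] in pth up sub maxp0 maxp E2 lS out_idx d1 d2 out3 *.
(* The longest path is a single vertex, so [S] spans no arcs. *)
- have noarc a b : a \in S -> b \in S -> r a b = false.
    move=> aS bS; apply/negP => rab; have ab : a != b by apply: contraTneq rab => ->; rewrite irr.
    have := maxp a [:: b]; rewrite /= rab inE ab => /(_ isT isT) H.
    by suff: 1 <= 0 by []; apply: H => z; rewrite !inE => /orP[] /eqP ->.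
  have [w [wS wx _]] := out3; exists x, w; split=> //; first by rewrite eq_sym.
    by rewrite noarc.
  split; rewrite leqW // leqn0 cards_eq0 -subset0; apply/subsetP => z.
    by rewrite !inE => /andP[zS]; rewrite noarc.
  by rewrite !inE => /andP[zS]; rewrite noarc.
- rewrite /= in out_idx d1 d2 out3 lS; have rxy : r x y1 by case/andP: pth.
  have nxy : x != y1 by move: up; rewrite /= inE andbT.
  (* If [x] and [y1] form a digon, a third vertex [w] replaces one of them; it is not joined to them
     the wrong way since no path in [S] has three vertices. *)
  have [ryx|nryx] := boolP (r y1 x); last by exists y1, x; split=> //; rewrite eq_sym.
  have [w [wS wx wy]] := out3.
  have no2 (a b c : V) : r a b -> r b c -> a \in S -> b \in S -> c \in S -> uniq [:: a; b; c] -> False.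
    move=> rab rbc aS bS cS u3; have := maxp a [:: b; c].
    rewrite /= rab rbc => /(_ isT u3) H.
    by suff: 2 <= 1 by []; apply: H => z; rewrite !inE => /or3P[] /eqP ->.
  have two a b : r a b -> a \in S -> b \in S ->
      #|[set w in S | r b w]| <= 1 /\ #|[set w in S | r w a]| <= 1.
    move=> rab aS bS; apply: (E2 a [:: b]) => //=; first by rewrite rab.
      by rewrite inE andbT; apply: contraTneq rab => ->; rewrite irr.
    by move=> z; rewrite !inE => /orP[] /eqP ->.
  have nyw : ~~ r y1 w.
    apply/negP => h; apply: (no2 x y1 w) => //.
    by rewrite /= !inE negb_or nxy eq_sym wx eq_sym wy.
  have nwx : ~~ r w x.
    by apply/negP => h; apply: (no2 w x y1) => //; rewrite /= !inE negb_or nxy wx wy.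
  have [/existsP[s /andP[sS rsw]]|nin] := boolP [exists s, (s \in S) && r s w].
    have [f1 f2] := two s w rsw sS wS.
    by exists w, x; split=> //; split=> //; have [] := two x y1 rxy xS lS.
  exists y1, w; split=> //; first by rewrite eq_sym.
  split=> //; rewrite leqW // leqn0 cards_eq0 -subset0; apply/subsetP => z.
  rewrite !inE => /andP[zS rzw]; case/negP: nin; apply/existsP; exists z.
  by rewrite zS.
- exists (last x [:: y1, y2 & p]), x; split=> //.
    by case/andP: up => h _; apply: contraNneq h => <-; apply: (mem_last y1 (y2 :: p)).
  by apply/negP => h; have [] := out_idx x xS h; rewrite /= eqxx.
Qed.
End LowDegreePair.

(** * Disjoint short cycles *)

Definition outs (V : finType) (r : rel V) v := [set w | r v w].
Definition ins (V : finType) (r : rel V) v := [set w | r w v].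
Definition missed (V : finType) (r : rel V) u v := [set w | ~~ r u w & ~~ r w v].

Section Greedy.
Variables (V : finType) (good : pred (seq V)).

(** Robust closability: [W] stands for the vertices outside [B] consumed by cycles built earlier. *)
Definition extendable (B : {set V}) d m (cfg : seq V) :=
  forall W : {set V}, #|W| <= m ->
  exists c, [/\ good c, uniq c, forall x, x \in c -> x \in B -> x \in cfg,
    forall x, x \in c -> x \notin B -> x \notin W & count [predC B] c <= d].

(** Configurations are closed one at a time. The last of at most [t.+1] meets at most [d * t]
    consumed vertices, which is the tolerance required of each. *)
Lemma greedy (B : {set V}) d t (L : seq (seq V)) :
  (forall cfg, cfg \in L -> extendable B d (d * t) cfg) -> size L <= t.+1 ->
  uniq (flatten L) ->
  exists s, [/\ size s = size L, all good s, uniq (flatten s),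
    forall x, x \in flatten s -> x \in B -> x \in flatten L
    & count [predC B] (flatten s) <= d * size L].
Proof.
elim: L => [|cfg L IH] ext /=; first by exists [::].
rewrite ltnS cat_uniq => szL /and3P[u1 disj u2].
have [||//|s [sz gs us sub cnt]] := IH.
- by move=> c cL; apply: ext; rewrite inE cL orbT.
- exact: leqW.
have [|c [gc uc cB cW cc]] := ext cfg (mem_head _ _) [set x in flatten s | x \notin B].
  apply: leq_trans (leq_mul (leqnn d) szL); apply: leq_trans cnt.
  rewrite -size_filter; apply: leq_trans (card_size _); apply: subset_leq_card.
  by apply/subsetP => x; rewrite inE mem_filter /= andbC.
exists (c :: s); rewrite /= sz gc gs cat_uniq uc us /= andbT; split=> //.
- apply/hasPn => x xs; apply/negP => /= xc.
  have [xB|xB] := boolP (x \in B).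
    by case/hasP: disj; exists x; [apply: sub | apply: cB].
  by have := cW x xc xB; rewrite inE xs xB.
- move=> x; rewrite !mem_cat => /orP[xc xB|xs xB].
    by rewrite (cB x).
  by rewrite (sub x) ?orbT.
- by rewrite count_cat mulnS leq_add.
Qed.
End Greedy.

(* A common neighbour [u -> w -> v] outside [A] closes a config to a cycle of length 3 or 4. *)
Definition config (V : finType) (r : rel V) (A : {set V}) v u :=
  [&& v \in A, u \in A, v != u & r v u || [exists m in A, r v m && r m u]].

Lemma config_conv (V : finType) (r : rel V) (A : {set V}) v u :
  config (conv r) A v u = config r A u v.
Proof.
rewrite /config /conv andbCA eq_sym; do 3!congr andb; congr orb.
by apply: eq_existsb => m; rewrite [r _ v && _]andbC.
Qed.

Lemma missed_conv (V : finType) (r : rel V) u v : missed (conv r) u v = missed r v u.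
Proof. by apply/setP => w; rewrite !inE andbC. Qed.

(** Inside [P] the out-degrees and the in-degrees have the same sum. *)
Lemma exists_large_indegree (V : finType) (r : rel V) (P : {set V}) d z :
  z \in P -> (forall z, z \in P -> d <= #|[set b in P | r z b]|) ->
  exists2 z, z \in P & d <= #|[set b in P | r b z]|.
Proof.
move=> zP dP; apply: NNPP => nex.
have lt_d x : x \in P -> #|[set b in P | r b x]| < d.
  by move=> xP; rewrite ltnNge; apply/negP => h; apply: nex; exists x.
have e1 : \sum_(x in P) #|[set b in P | r x b]| = \sum_(x in P) #|[set b in P | r b x]|.
  under eq_bigr do rewrite -sum1dep_card big_mkcondr.
  rewrite exchange_big; apply: eq_bigr => x _.
  by rewrite -big_mkcondr sum1dep_card.
have le1 : #|P| * d <= \sum_(x in P) #|[set b in P | r x b]|.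
  by rewrite -sum_nat_const; apply: leq_sum.
have le2 : \sum_(x in P) #|[set b in P | r b x]| + #|P| <= #|P| * d.
  by rewrite -[X in _ + X]sum1_card -big_split -sum_nat_const; apply: leq_sum => x /lt_d; rewrite /= addn1.
have : 0 < #|P| by apply/card_gt0P; exists z.
by move: le1 le2; rewrite e1; lia.
Qed.

(** * Local degree bound in a set without directed triangles *)

Section LocalDegree.
Variables (V : finType) (r : rel V) (A : {set V}) (m0 : nat).
Hypothesis irr : irreflexive r.
Hypothesis m0_gt0 : 0 < m0.
Hypothesis no3 : forall a b c, a \in A -> b \in A -> c \in A ->
  r a b -> r b c -> r c a -> False.
Hypothesis few : forall v u, config r A v u -> ~~ r u v -> #|missed r u v| <= m0.

(** The out-neighbours of [y] split into [S], joined to [y] both ways, and [P], joined one way.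
    Triangle-freeness makes [S] independent and forbids arcs from [P] to [S]; inside [P] few arcs
    are missing, so a large [P] would contain a triangle. *)
Lemma local_outdeg y : y \in A -> #|[set w in A | r y w]| <= m0.*2.
Proof.
move=> yA; pose S := [set w in A | r y w & r w y].
pose P := [set w in A | r y w & ~~ r w y].
have -> : #|[set w in A | r y w]| = #|S| + #|P|.
  rewrite -cardsUI -[LHS]addn0; congr (_ + _).
    by apply: eq_card => w; rewrite !inE -!andb_orr orbN !andbT.
  apply/esym/eqP; rewrite cards_eq0 -subset0; apply/subsetP => w.
  by rewrite !inE => /andP[/and3P[_ _ ->]]; rewrite !andbF.
have inS w : w \in S -> [/\ w \in A, r y w & r w y] by rewrite !inE => /and3P[].
have inP w : w \in P -> [/\ w \in A, r y w & ~~ r w y] by rewrite !inE => /and3P[].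
have SS a b : a \in S -> b \in S -> ~~ r a b.
  by move=> /inS[aA ya ay] /inS[bA yb yb']; apply/negP => ab; apply: (no3 yA aA bA).
have PS a b : a \in P -> b \in S -> ~~ r a b.
  by move=> /inP[aA ya ay] /inS[bA yb yb']; apply/negP => ab; apply: (no3 yA aA bA).
have neq a b : r a b -> a != b by move=> h; apply: contraTneq h => ->; rewrite irr.
(* With [v = y] if [S] is empty and [v] in [S] otherwise, the missed set of the configuration ending
   in [z] contains both sets counted here. *)
have Pz z : z \in P -> #|S| + #|[set b in P | ~~ r z b]| <= m0.
  move=> zP; have [zA yz zy] := inP z zP.
  rewrite -cardsUI [_ :&: _](_ : _ = set0) ?cards0 ?addn0; last first.
    by apply/setP => b; rewrite !inE; case: (r b y); rewrite /= ?andbF.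
  have [S0|[s' s'S]] := set_0Vmem S.
    rewrite S0 set0U; apply: leq_trans (few (v := y) (u := z) _ _) => //; last first.
      by rewrite /config yA zA yz neq.
    by apply/subset_leq_card/subsetP => b; rewrite !inE => /andP[/and3P[_ _ ->] ->].
  have [s'A ys' s'y] := inS s' s'S.
  apply: leq_trans (few (v := s') (u := z) _ _); last by apply: PS.
    apply/subset_leq_card/subsetP => b; rewrite in_setU => /orP[bS|].
      by rewrite inE PS //= SS.
    rewrite inE => /andP[bP zb]; rewrite inE zb /=.
    have [bA yb nby] := inP b bP.
    by apply/negP => bs; apply: (no3 yA bA s'A).
  rewrite /config s'A zA /=; apply/andP; split; first by apply: contraNneq zy => <-.
  by apply/orP; right; apply/existsP; exists y; rewrite yA s'y.
have [P0|[z zP]] := set_0Vmem P.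
  rewrite P0 cards0 addn0; have [lt2|ge2] := leqP #|S| 1; first by lia.
  have [a [b [aS bS ab]]] : exists a b, [/\ a \in S, b \in S & a != b].
    by move/card_gt1P: ge2 => [a [b [? ? ?]]]; exists a, b.
  have [[aA ya ay] [bA yb by_]] := (inS a aS, inS b bS).
  apply: leq_trans (_ : m0 <= _); last by lia.
  apply: leq_trans (few (v := a) (u := b) _ _); last by apply: SS.
    by apply/subset_leq_card/subsetP => c cS; rewrite inE !SS.
  rewrite /config aA bA ab /=; apply/orP; right; apply/existsP; exists y.
  by rewrite yA ay.
pose m := m0 - #|S|.
have dP z' : z' \in P -> #|P| - m <= #|[set b in P | r z' b]|.
  move=> z'P; have := Pz z' z'P; rewrite -(cardsID [set b | r z' b] P).
  have -> : P :&: [set b | r z' b] = [set b in P | r z' b] by apply/setP => b; rewrite !inE.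
  have -> : P :\: [set b | r z' b] = [set b in P | ~~ r z' b].
    by apply/setP => b; rewrite !inE andbC.
  by rewrite /m; lia.
have le_S := Pz z zP.
have [leP|ltP] := leqP #|P| m.*2; first by move: leP le_S; rewrite /m; lia.
(* If [P] had more than [2m] elements, the out-neighbours of [u] and the in-neighbours of [z0] in
   [P] would intersect, giving a triangle. Hence [#|S| + #|P|] is at most [#|S| + 2 (m0 - #|S|)]. *)
have [z0 z0P inz0] := exists_large_indegree zP dP.
have [u uin] : exists u, u \in [set b in P | r z0 b].
  by apply/set0Pn; rewrite -card_gt0; have := dP z0 z0P; lia.
move: uin; rewrite inE => /andP[uP z0u].
have [w win] : exists w, w \in [set b in P | r u b] :&: [set b in P | r b z0].
  apply/set0Pn; rewrite -card_gt0; have := dP u uP.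
  have := cardsUI [set b in P | r u b] [set b in P | r b z0].
  have : #|[set b in P | r u b] :|: [set b in P | r b z0]| <= #|P|.
    by apply/subset_leq_card/subsetP => b; rewrite in_setU !inE -andb_orr => /andP[].
  by lia.
move: win; rewrite in_setI => /andP[]; rewrite inE => /andP[wP uw]; rewrite inE => /andP[_ wz].
have [[[a1 _ _] [a2 _ _]] [a3 _ _]] := (inP z0 z0P, inP u uP, inP w wP).
by case: (no3 a1 a2 a3 z0u uw wz).
Qed.
End LocalDegree.

(* What remains of [sigma11_ge] once the edges of the matching are contracted:
   an arc [u -> w] stands for an edge from [u] to the mate of [w]. *)
Definition ore (V : finType) (r : rel V) :=
  forall u v, u != v -> ~~ r u v -> #|V| <= #|outs r u| + #|ins r v|.

Lemma ore_conv (V : finType) (r : rel V) : ore r -> ore (conv r).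
Proof. by move=> W u v uv nr; rewrite addnC; apply: W; rewrite // eq_sym. Qed.

Section Common.
Variables (V : finType) (r : rel V).
Hypothesis W : ore r.

(** Inclusion-exclusion: the two neighbourhoods have total size at least [#|V|], so they overlap at
    least as much as they miss. *)
Lemma le_missed_common u v : u != v -> ~~ r u v ->
  #|missed r u v| <= #|outs r u :&: ins r v|.
Proof.
move=> uv nr; have := W uv nr; have := cardsUI (outs r u) (ins r v).
have := cardsC (outs r u :|: ins r v).
have -> : ~: (outs r u :|: ins r v) = missed r u v.
  by apply/setP => w; rewrite !inE negb_or.
lia.
Qed.
End Common.

Definition short (V : finType) (r : rel V) c := dcyc r c && (size c <= 4).

Lemma size_flatten_short (V : finType) (r : rel V) s :
  all (short r) s -> size (flatten s) <= 4 * size s.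
Proof.
elim: s => //= c s IH /andP[/andP[_ sc] /IH].
by rewrite size_cat mulnS => h; apply: leq_add.
Qed.

(** * From t to t + 1 disjoint short cycles *)

Section ShortStep.
Variables (V : finType) (r : rel V).
Hypothesis irr : irreflexive r.
Hypothesis W : ore r.
Variable s : seq (seq V).
Hypothesis shs : all (short r) s.
Hypothesis us : uniq (flatten s).
Let t := size s.
Hypothesis large : 12 * t + 15 <= #|V|.
Hypothesis stuck : ~ exists s', [/\ size s' = t.+1, all (short r) s' & uniq (flatten s')].

Lemma neq_arc a b : r a b -> a != b.
Proof. by apply: contraTneq => ->; rewrite irr. Qed.

Lemma short3 a b c : r a b -> r b c -> r c a -> short r [:: a; b; c].
Proof.
move=> ab bc ca; rewrite /short /dcyc /= ab bc ca !inE negb_or.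
by rewrite (neq_arc ab) (neq_arc bc) eq_sym (neq_arc ca).
Qed.

Lemma short4 a b c d : r a b -> r b c -> r c d -> r d a -> a != c -> b != d ->
  short r [:: a; b; c; d].
Proof.
move=> ab bc cd da ac bd; rewrite /short /dcyc /= ab bc cd da !inE !negb_or.
by rewrite (neq_arc ab) (neq_arc bc) (neq_arc cd) (eq_sym a d) (neq_arc da) ac bd.
Qed.

Let H0 := [set x | x \notin flatten s].

Lemma free_size : 8 * t + 15 <= #|H0|.
Proof.
have := size_flatten_short shs; have := cardsC [set x in flatten s].
have -> : ~: [set x in flatten s] = H0 by apply/setP => x; rewrite !inE.
have : #|[set x in flatten s]| <= size (flatten s) by rewrite cardsE card_size.
by move: large; rewrite -/t; lia.
Qed.

Lemma no_short_free c : short r c -> {subset c <= H0} -> False.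
Proof.
move=> shc sub; apply: stuck; exists (c :: s); rewrite /= shc shs cat_uniq us.
case/andP: (shc) => /dcyc_uniq -> _; split=> //; rewrite andbT /=.
by apply/hasPn => x xs; apply/negP => /sub; rewrite inE xs.
Qed.

(** There are more than [t + 1] vertices [w] with [u -> w -> v]. None lies in [H0], except possibly
    the middle vertex of the configuration, since it would close a short cycle among the free
    vertices. So after [t] forbidden vertices one still remains, and it lies on a cycle of [s]. *)
Lemma config_extendable (A : {set V}) v u : A \subset H0 -> config r A v u -> ~~ r u v ->
  t.+1 < #|missed r u v| ->
  exists2 cfg, extendable (short r) H0 1 (1 * t) cfg &
    [/\ uniq cfg, 0 < size cfg <= 3 & {subset cfg <= A}].
Proof.
move=> /subsetP AH /and4P[vA uA vu cfg] nuv lt_miss.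
have [vH uH] := (AH v vA, AH u uA).
have {}lt_miss : t.+1 < #|outs r u :&: ins r v|.
  by apply: leq_trans lt_miss _; apply: le_missed_common; rewrite // eq_sym.
have ext m (M : {set V}) : {subset (v :: m) <= H0} -> 
   (forall w, r u w -> r w v -> w \notin M -> short r (w :: v :: rcons m u)) ->
   #|M| <= 1 -> (forall w, r u w -> r w v -> w \in H0 -> w \in M) ->
   extendable (short r) H0 1 (1 * t) (v :: rcons m u).
  move=> sub sh M1 inM W0; rewrite mul1n => cW.
  have : 0 < #|(outs r u :&: ins r v) :\: (M :|: W0)|.
    rewrite cardsD; have := cardsUI M W0.
    have := subset_leq_card (subsetIr (outs r u :&: ins r v) (M :|: W0)).
    by lia.
  case/card_gt0P => w; rewrite !inE negb_or => /andP[/andP[wM wW] /andP[uw wv]].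
  exists (w :: v :: rcons m u); have shw := sh w uw wv wM.
  have wH : w \notin H0 by apply: contra wM; apply: inM.
  have subH x : x \in v :: rcons m u -> x \in H0.
    by rewrite inE mem_rcons inE => /or3P[/eqP->|/eqP->|xm] //; apply: sub; rewrite inE xm orbT.
  split=> //.
  - by case/andP: shw => /dcyc_uniq.
  - by move=> x; rewrite inE => /orP[/eqP-> h|]; [rewrite h in wH | ].
  - by move=> x; rewrite inE => /orP[/eqP-> //|/subH ->].
  - rewrite /= wH; rewrite -[1]addn0 leq_add2l leqn0 -/(count _ (v :: _)).
    by rewrite -leqn0 leqNgt -has_count; apply/hasPn => x /subH /= ->.
have [rvu|nvu] := boolP (r v u).
  exists [:: v; u]; last first.
    by split; rewrite /= ?inE ?vu // => x; rewrite 2!inE => /orP[] /eqP->.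
  apply: (ext [::] set0) => [x|w uw wv _||w uw wv wH]; rewrite ?inE ?cards0 //.
  - by move/eqP->; rewrite inE in vH.
  - exact: short3.
  - case: (@no_short_free [:: w; v; u]); first exact: short3.
    by move=> x; rewrite 3!inE => /or3P[] /eqP->.
have {nvu cfg} [m [mA vm mu]] : exists m, [/\ m \in A, r v m & r m u].
  by case/orP: cfg => [h|/existsP[m /and3P[? ? ?]]]; [rewrite h in nvu|exists m].
have mH := AH m mA.
have sh w : r u w -> r w v -> w \notin [set m] -> short r [:: w; v; m; u].
  by move=> uw wv; rewrite inE => wm; apply: short4.
exists [:: v; m; u]; last first.
  split; rewrite /= ?inE ?negb_or ?vu ?(neq_arc vm) ?(neq_arc mu) // => x.
  by rewrite 3!inE => /or3P[] /eqP->.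
apply: (ext [:: m] [set m]) => [x|//||w uw wv wH].
- by rewrite 2!inE => /orP[] /eqP->.
- by rewrite cards1.
- apply: contraT => wm; case: (no_short_free (sh w uw wv wm)) => x.
  by rewrite 4!inE => /or4P[] /eqP->.
Qed.
End ShortStep.

Lemma disjoint_subpairs (V : finType) (A : {set V}) (adj : rel V) t :
  (forall x y z, x \in A -> y \in A -> z \in A -> y != z -> adj x y -> adj x z -> False) ->
  t.*2 < #|A| ->
  exists L : seq (seq V), [/\ size L = t, uniq (flatten L) &
    forall cfg, cfg \in L -> exists u v, [/\ cfg = [:: u; v], u \in A, v \in A, u != v & ~~ adj u v]].
Proof.
move=> deg1; suff H : t.*2 < #|A| -> exists L : seq (seq V),
    [/\ size L = t, uniq (flatten L), {subset flatten L <= A} &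
    forall cfg, cfg \in L -> exists u v, [/\ cfg = [:: u; v], u \in A, v \in A, u != v & ~~ adj u v]].
  by move=> /H[L [? ? _ ?]]; exists L.
elim: t => [_|t IH lt]; first by exists [::].
have [|L [sL uL LA cL]] := IH; first by move: lt; lia.
have sz : size (flatten L) = t.*2.
  rewrite -sL; elim: (L) cL => //= c L' IHL cL.
  rewrite size_cat IHL => [|c' c'L]; last by apply: cL; rewrite inE c'L orbT.
  by have [u [v [-> _]]] := cL c (mem_head _ _).
have cf : #|A :\: [set x in flatten L]| > 2.
  rewrite cardsD; have := subset_leq_card (subsetIr A [set x in flatten L]).
  have : #|[set x in flatten L]| <= size (flatten L) by rewrite cardsE card_size.
  by move: lt; lia.
have [u [v [w [uA vA wA [uv vw wu]]]]] : exists u v w,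
    [/\ u \in A :\: [set x in flatten L], v \in A :\: [set x in flatten L],
        w \in A :\: [set x in flatten L] & [/\ u != v, v != w & w != u]].
  by case/card_gt2P: cf => u [v [w [[? ? ?] [? ? ?]]]]; exists u, v, w.
have [v' [v'A uv' nuv']] : exists v', [/\ v' \in A :\: [set x in flatten L], u != v' & ~~ adj u v'].
  have [auv|] := boolP (adj u v); last by exists v.
  exists w; split; rewrite // 1?eq_sym //; apply/negP => auw.
  move: uA vA wA; rewrite !inE => /andP[_ uA] /andP[_ vA] /andP[_ wA].
  exact: (deg1 u v w).
move: uA v'A; rewrite !inE => /andP[uL' uA] /andP[v'L v'A].
exists ([:: u; v'] :: L); split=> [|||cfg]; first by rewrite /= sL.
- by rewrite /= inE negb_or uv' uL' v'L.
- by move=> x; rewrite /= 2!inE => /or3P[/eqP->|/eqP->|/LA].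
- by rewrite inE => /orP[/eqP->|/cL //]; exists u, v'.
Qed.

Section Short.
Variables (V : finType) (r : rel V).
Hypothesis irr : irreflexive r.
Hypothesis W : ore r.

(** The new cycles may reuse the vertices of [s], so in both applications of [greedy] the old family
    is discarded, not extended. *)
Lemma short_step s : all (short r) s -> uniq (flatten s) -> 12 * size s + 15 <= #|V| ->
  exists s', [/\ size s' = (size s).+1, all (short r) s' & uniq (flatten s')].
Proof.
move=> shs us large; apply: NNPP => stuck; set t := size s in large stuck.
pose H0 := [set x | x \notin flatten s].
pose okL (L : seq (seq V)) := uniq (flatten L) /\ forall cfg, cfg \in L ->
  [/\ extendable (short r) H0 1 (1 * t) cfg, 0 < size cfg <= 3 & {subset cfg <= H0}].
have [||L [uL okc] maxL] := @ex_max_measure _ okL size #|V| [::].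
- by split.
- move=> L [uL okc]; apply: leq_trans (size_uniq_le uL).
  elim: L okc {uL} => //= c L IH okc; rewrite size_cat -add1n; apply: leq_add.
    by have [_ /andP[]] := okc c (mem_head _ _).
  by apply: IH => c' c'L; apply: okc; rewrite inE c'L orbT.
(* Otherwise [t + 1] configurations close up, each with one vertex outside [H0]. *)
have szL : size L <= t.
  rewrite leqNgt; apply/negP => lt; apply: stuck.
  have tk c : c \in take t.+1 L -> c \in L by apply: mem_take.
  have [|||s' [sz' sh' us' _ _]] := @greedy V (short r) H0 1 t (take t.+1 L).
  - by move=> cfg /tk/okc[].
  - by rewrite size_takel.
  - by move: uL; rewrite -{1}(cat_take_drop t.+1 L) flatten_cat cat_uniq => /andP[].
  by exists s'; split=> //; rewrite sz' size_takel.
have szfL : size (flatten L) <= 3 * t.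
  apply: leq_trans (_ : 3 * size L <= _); last by rewrite leq_mul2l.
  elim: (L) okc => //= c L' IH okc; rewrite size_cat mulnS; apply: leq_add.
    by have [_ /andP[]] := okc c (mem_head _ _).
  by apply: IH => c' c'L; apply: okc; rewrite inE c'L orbT.
pose A := H0 :\: [set x in flatten L].
have AH : A \subset H0 by apply: subsetDl.
have szA : 5 * t + 15 <= #|A|.
  rewrite /A cardsD; have := subset_leq_card (subsetIr H0 [set x in flatten L]).
  have : #|[set x in flatten L]| <= size (flatten L) by rewrite cardsE card_size.
  by have := free_size shs us large; rewrite -/t -/H0; lia.
(* A configuration in [A] with a larger missed set could be added to [L]. *)
have few v u : config r A v u -> ~~ r u v -> #|missed r u v| <= t.+1.
  move=> cfg nuv; rewrite leqNgt; apply/negP => lt.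
  have [c ext [uc /andP[c0 c3] cA]] := config_extendable irr W shs us large stuck AH cfg nuv lt.
  have := maxL (c :: L); rewrite /= ltnn => h; suff: false by []; apply: h; split.
    rewrite /= cat_uniq uc uL andbT; apply/hasPn => x xL; apply/negP => /cA.
    by rewrite !inE xL.
  move=> c'; rewrite inE => /orP[/eqP->|/okc //]; split=> //; first by rewrite c0.
  by move=> x /cA; apply: (subsetP AH).
have no3 a b c : a \in A -> b \in A -> c \in A -> r a b -> r b c -> r c a -> False.
  move=> aA bA cA ab bc ca; apply: (no_short_free shs us stuck (short3 irr ab bc ca)) => x.
  by rewrite 3!inE => /or3P[] /eqP->; apply: (subsetP AH).
clearbody A.
(* If the arc were absent, [A] would be covered by [t + 1] missed vertices and two neighbourhoods of
   size at most [2 (t + 1)], too few for its size. *)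
have nocfg v u : config r A v u -> r u v.
  move=> cfg; apply: contraT => nuv; have le1 := few v u cfg nuv.
  have [vA uA] : v \in A /\ u \in A by case/and4P: cfg.
  have lu := local_outdeg irr (ltn0Sn t) no3 few uA.
  have lv : #|[set w in A | conv r v w]| <= t.+1.*2.
    apply: (@local_outdeg V (conv r)) => //.
    - by move=> a b c aA bA cA ba cb ac; apply: (no3 a c b).
    - move=> v' u'; rewrite config_conv => cfg' nr.
      by rewrite missed_conv; apply: few.
  have : #|A| <= #|missed r u v :|: ([set w in A | r u w] :|: [set w in A | conv r v w])|.
    apply/subset_leq_card/subsetP => w wA; rewrite !inE wA /conv.
    by do 2!case: (r _ _).
  have := (leq_card_setU (missed r u v) ([set w in A | r u w] :|: [set w in A | conv r v w])).1.
  have := (leq_card_setU [set w in A | r u w] [set w in A | conv r v w]).1.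
  by lia.
have neq a b (ab : r a b) : a != b := neq_arc irr ab.
have sym x y : x \in A -> y \in A -> r x y -> r y x.
  by move=> xA yA xy; apply: nocfg; rewrite /config xA yA neq //= xy.
(* By now [r] is symmetric and transitive enough on [A] that two neighbours of one vertex are
   adjacent, which gives a triangle; so [r] is a matching on [A]. *)
have deg1 x y z : x \in A -> y \in A -> z \in A -> y != z -> r x y -> r x z -> False.
  move=> xA yA zA yz xy xz; apply: (no3 x y z) => //; last exact: sym.
  apply: nocfg; rewrite /config zA yA eq_sym yz /=; apply/orP; right.
  by apply/existsP; exists x; rewrite xA sym.
have [|Q [sQ uQ cQ]] := disjoint_subpairs (t := t.+1) deg1; first by lia.
have one x : x \in A -> #|[set w in A | r x w]| <= 1.
  move=> xA; rewrite leqNgt; apply/negP => /card_gt1P[a [b []]].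
  by rewrite !inE => /andP[aA xa] /andP[bA xb] ab; apply: (deg1 x a b).
have common x y : x \in A -> y \in A -> x != y -> ~~ r x y ->
    5 * t + 13 <= #|outs r x :&: ins r y|.
  move=> xA yA xy nxy; apply: leq_trans (le_missed_common W xy nxy).
  have : #|A| <= #|missed r x y :|: ([set w in A | r x w] :|: [set w in A | r y w])|.
    apply/subset_leq_card/subsetP => w wA; rewrite in_setU in_setU !inE wA /=.
    have := @sym w y wA yA; case: (r x w) => //=; case: (r w y) => //= ->; rewrite ?orbT //.
  have := (leq_card_setU (missed r x y) ([set w in A | r x w] :|: [set w in A | r y w])).1.
  have := (leq_card_setU [set w in A | r x w] [set w in A | r y w]).1.
  by move: (one x xA) (one y yA) szA; clear; lia.
have noA x y w : x \in A -> y \in A -> x != y -> w \in outs r x :&: ins r y -> w \notin A.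
  move=> xA yA xy; rewrite !inE => /andP[xw wy]; apply/negP => wA.
  by apply: (deg1 w x y) => //; apply: sym.
have pick x y (W0 : {set V}) : x \in A -> y \in A -> x != y -> ~~ r x y -> #|W0| <= 2 * t + 1 ->
    exists w, [/\ r x w, r w y, w \notin A & w \notin W0].
  move=> xA yA xy nxy cW; have : 0 < #|(outs r x :&: ins r y) :\: W0|.
    rewrite cardsD; have := subset_leq_card (subsetIr (outs r x :&: ins r y) W0).
    by move: (common x y xA yA xy nxy) cW; clear; lia.
  case/card_gt0P => w; rewrite inE => /andP[wW wI].
  have wA := noA x y w xA yA xy wI.
  by move: wI; rewrite !inE => /andP[]; exists w.
apply: stuck.
(* Each nonadjacent pair [u], [v] closes to a 4-cycle through two vertices outside [A]. The second
   choice avoids the first as well, whence the [+ 1] in [pick]. *)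
have [|||s' [sz' sh' us' _ _]] := @greedy V (short r) A 2 t Q; rewrite ?sQ //.
- move=> cfg /cQ[u [v [-> uA vA uv nuv]]] W0 cW.
  have nvu : ~~ r v u by apply: contra nuv; apply: sym.
  have [|w [uw wv wA wW]] := pick u v W0 uA vA uv nuv; first exact: leq_trans cW (leq_addr _ _).
  have [||w' [vw' w'u w'A]] := pick v u (w |: W0) vA uA _ nvu; rewrite 1?eq_sym //.
    by rewrite cardsU1 wW addnC leq_add2r.
  rewrite !inE negb_or => /andP[w'w w'W].
  have sh : short r [:: u; w; v; w'] by apply: short4; rewrite // eq_sym.
  exists [:: u; w; v; w']; split=> //.
  + by case/andP: sh => /dcyc_uniq.
  + by move=> x; rewrite !inE => /or4P[] /eqP->; rewrite ?eqxx ?orbT ?(negPf wA) ?(negPf w'A).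
  + by move=> x; rewrite !inE => /or4P[] /eqP->; rewrite ?uA ?vA ?wW ?w'W.
  + by rewrite /= uA vA wA w'A.
by exists s'; rewrite sz' sQ.
Qed.

Lemma short_family k : 0 < k -> 12 * k + 3 <= #|V| ->
  exists s, [/\ size s = k, all (short r) s & uniq (flatten s)].
Proof.
move=> k0 large; have : forall j, j <= k -> exists s, [/\ size s = j, all (short r) s & uniq (flatten s)].
  elim=> [_|j IH lt]; first by exists [::].
  have [s [sz sh us]] := IH (ltnW lt).
  by rewrite -sz; apply: short_step => //; rewrite sz; lia.
exact.
Qed.
End Short.

(** * Cycles through semicomplete sets *)

Lemma split_last (T : Type) (a : pred T) s : has a s ->
  exists s1 x s2, [/\ s = s1 ++ x :: s2, a x & ~~ has a s2].
Proof.
elim: s => //= y s IH; have [/IH[s1 [x [s2 [-> ax ns2]]]] _|ns] := boolP (has a s).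
  by exists (y :: s1), x, s2.
by rewrite orbF => ay; exists [::], y, s.
Qed.

Lemma split_first (T : Type) (a : pred T) s : has a s ->
  exists s1 x s2, [/\ s = s1 ++ x :: s2, a x & ~~ has a s1].
Proof.
elim: s => //= y s IH; have [ay _|nay /IH[s1 [x [s2 [-> ax ns1]]]]] := boolP (a y).
  by exists [::], y, s.
by exists (y :: s1), x, s2; rewrite /= negb_or nay.
Qed.

Section Cover.
Variables (V : finType) (r : rel V).
Implicit Types (c p q : seq V) (S L : {set V}) (x y z : V).

Definition within S : rel V := fun x y => [&& x \in S, y \in S & r x y].

Lemma path_within S x p : path (within S) x p -> path r x p /\ {subset p <= S}.
Proof.
elim: p x => //= y p IH x /andP[/and3P[xS yS xy] /IH[pth sub]]; rewrite xy pth.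
by split=> // z; rewrite inE => /orP[/eqP->|/sub].
Qed.

Lemma connect_within S x y : connect (within S) x y -> x \in S ->
  exists p, [/\ path r x p, last x p = y, uniq (x :: p) & {subset x :: p <= S}].
Proof.
move=> /connectP[p pth ->] xS; case/shortenP: pth => p' pth up _.
have [pr sub] := path_within pth; exists p'; split=> // z.
by rewrite inE => /orP[/eqP->|/sub].
Qed.

(** Unlike [dcyc] it admits digons: absorption may have to start from one. *)
Definition ring_in S c := [&& cycle r c, uniq c, 1 < size c & all [in S] c].

Definition semicomplete (L : {set V}) :=
  {in L &, forall x y, x != y -> r x y || r y x}.

Lemma ring_rot S n c : ring_in S (rot n c) = ring_in S c.
Proof.
rewrite /ring_in rot_cycle rot_uniq size_rot; do 3!congr (_ && _).
by apply: eq_all_r => x; rewrite mem_rot.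
Qed.

(** Follow the path from [l] to its first vertex [y] on [c], then [c] from [y] to the last vertex of
    [L] before returning to [y], then the arc back to [l]. The skipped part of [c] contains no
    vertex of [L]. *)
Lemma absorb_last S L c l : ring_in S c -> l \in S -> l \notin c ->
    (forall g, g \in L -> g \in c -> r g l) ->
    (exists g, [/\ g \in L, g \in c & connect (within S) l g]) ->
  exists c', [/\ ring_in S c', l \in c' & forall g, g \in L -> g \in c -> g \in c'].
Proof.
move=> rc lS lc inl [g [gL gc /connect_within/(_ lS)[p [pth lst up sub]]]].
have hp : has [in c] p.
  case: p => [|y p] in pth lst up sub *; first by rewrite -lst /= (negPf lc) in gc.
  by apply/hasP; exists g; rewrite // -lst /= mem_last.
have [p1 [y [p2 [ep yc np1]]]] := split_first hp.
have [i t et] := rot_to yc.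
have rt : ring_in S (y :: t) by rewrite -et ring_rot.
have mt z : (z \in y :: t) = (z \in c) by rewrite -et mem_rot.
have hL : has [in L] (y :: t) by apply/hasP; exists g; rewrite // mt.
have [q1 [g1 [q2 [eq g1L nq2]]]] := split_last hL.
have g1c : g1 \in c by rewrite -mt eq mem_cat mem_head orbT.
case/and4P: rt => cy uy _ /allP Sy.
exists (rcons q1 g1 ++ l :: p1).
have sp z : z \in l :: p1 -> z \in S /\ z \notin c.
  move=> zin; split; first by apply: sub; rewrite ep -cat_cons mem_cat zin.
  by move: zin; rewrite inE => /orP[/eqP->//|zp]; apply: (hasPn np1).
have hd : exists q1', rcons q1 g1 = y :: q1'.
  by case: (q1) eq => [|? q1'] [->]; [exists [::] | exists (rcons q1' g1)].
have [q1' eq1] := hd.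
have eq' : y :: t = rcons q1 g1 ++ q2 by rewrite cat_rcons.
split.
- rewrite /ring_in; apply/and4P; split.
  + move: cy; rewrite eq' eq1 /= !rcons_cat !cat_path => /andP[-> _] /=.
    have -> : last y q1' = g1 by rewrite -(last_rcons y q1 g1) eq1.
    rewrite inl //= rcons_path; move: pth; rewrite ep cat_path /= => /and3P[-> -> _].
    by [].
  + rewrite cat_uniq; move: uy; rewrite eq' cat_uniq => /andP[-> _].
    rewrite andTb; apply/andP; split.
      apply/hasPn => z /sp[_]; apply: contra => zq; rewrite -mt eq' mem_cat zq.
      by [].
    by move: up; rewrite ep /= mem_cat negb_or cat_uniq => /andP[/andP[-> _] /andP[->]].
  + by rewrite size_cat size_rcons /= addSn addnS.
  + rewrite all_cat; apply/andP; split; apply/allP => z zin; last by case: (sp z zin).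
    by apply: Sy; rewrite eq' mem_cat zin.
- by rewrite mem_cat mem_head orbT.
- move=> z zL; rewrite -mt eq' mem_cat => /orP[zq|zq]; first by rewrite mem_cat zq.
  by case/hasPn/(_ z zq)/negP: nq2.
Qed.
End Cover.

Lemma ring_rev (V : finType) (r : rel V) S c : ring_in (conv r) S (rev c) = ring_in r S c.
Proof. by rewrite /ring_in rev_cycle rev_uniq size_rev all_rev. Qed.

Lemma connect_within_conv (V : finType) (r : rel V) (S : {set V}) x y :
  connect (within (conv r) S) x y = connect (within r S) y x.
Proof.
have := connect_rev (within r S) x y; rewrite /= => <-; apply: eq_connect => a b /=.
by rewrite /within /conv andbCA.
Qed.

Section CoverCycle.
Variables (V : finType) (r : rel V).
Implicit Types (c p q : seq V) (S L : {set V}) (x y z : V).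

Lemma absorb_first S L c l : ring_in r S c -> l \in S -> l \notin c ->
    (forall g, g \in L -> g \in c -> r l g) ->
    (exists g, [/\ g \in L, g \in c & connect (within r S) g l]) ->
  exists c', [/\ ring_in r S c', l \in c' & forall g, g \in L -> g \in c -> g \in c'].
Proof.
move=> rc lS lc inl [g [gL gc con]].
have [|//|||c' [rc' lc' sub]] := @absorb_last _ (conv r) S L (rev c) l _ lS; rewrite ?ring_rev ?mem_rev //.
- by move=> g'; rewrite mem_rev; apply: inl.
- by exists g; rewrite mem_rev connect_within_conv.
exists (rev c'); rewrite mem_rev -ring_rev revK; split=> // g' gL' gc'.
by rewrite mem_rev; apply: sub; rewrite ?mem_rev.
Qed.

Lemma absorb S L c l : semicomplete r L -> L \subset S -> ring_in r S c ->
    has [in L] c -> l \in L -> l \notin c ->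
    {in L &, forall x y, connect (within r S) x y} ->
  exists c', [/\ ring_in r S c', l \in c' & forall g, g \in L -> g \in c -> g \in c'].
Proof.
move=> sc /subsetP LS rc /hasP[g0 g0c /= g0L] lL lc con.
have lS := LS l lL.
have nl g : g \in c -> g != l by apply: contraTneq => ->.
have [/existsP[x /and3P[xL xc xl]]|no_in] := boolP [exists x, [&& x \in L, x \in c & r x l]]; last first.
  apply: absorb_first => // [g gL gc|]; last by exists g0; split=> //; apply: con.
  have := sc g l gL lL (nl g gc); case/orP => // gl.
  by case/negP: no_in; apply/existsP; exists g; rewrite gL gc.
have [/existsP[y /and3P[yL yc ly]]|no_out] := boolP [exists x, [&& x \in L, x \in c & r l x]]; last first.
  apply: absorb_last => // [g gL gc|]; last by exists g0; split=> //; apply: con.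
  have := sc g l gL lL (nl g gc); case/orP => // gl.
  by case/negP: no_out; apply/existsP; exists g; rewrite gL gc.
(* Segments of [c], as a first vertex, a tail and the complementary part, that start at an
   out-neighbour and end at an in-neighbour of [l], both in [L]. *)
pose P (a : V * seq V * seq V) := (exists i, rot i c = a.1.1 :: a.1.2 ++ a.2) /\
  [/\ a.1.1 \in L, r l a.1.1, last a.1.1 a.1.2 \in L & r (last a.1.1 a.1.2) l].
have [a0 Pa0] : exists a, P a.
  have [i t et] := rot_to yc.
  have xin : x \in y :: t by rewrite -et mem_rot.
  case/splitPl: xin et => p1 p2 lst et; exists ((y, p1), p2); split; first by exists i.
  by rewrite /= lst.
have [|[[y' p1] p2] [[i ei] [/= y'L ly' zL zl]] maxP] :=
    @ex_max_measure _ P (fun a => size a.1.2) (size c) a0 Pa0.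
  move=> [[a1 a2] a3] [[i /= ei] _]; rewrite -(size_rot i c) ei /= size_cat.
  by apply: leqW; apply: leq_addr.
have rt : ring_in r S (y' :: p1 ++ p2) by rewrite -ei ring_rot.
have mt z : (z \in y' :: p1 ++ p2) = (z \in c) by rewrite -ei mem_rot.
(* A vertex [w] of [L] beyond the longest segment is joined to [l] in some direction, and the
   segment could be prolonged forwards or backwards to [w]. *)
have no2 : ~~ has [in L] p2.
  apply/negP => /hasP[w wp wL]; have wc : w \in c by rewrite -mt inE mem_cat wp !orbT.
  case/splitPr: wp ei maxP rt mt => {}p2 p3 ei maxP rt mt.
  have := sc w l wL lL (nl w wc); case/orP => lw.
    have := maxP (y', p1 ++ rcons p2 w, p3); rewrite /= size_cat size_rcons.
    rewrite leqNgt; suff -> : size p1 < size p1 + (size p2).+1.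
      move=> h; suff: false by []; apply: h; split; last by rewrite last_cat last_rcons.
      by exists i; rewrite /= -catA cat_rcons.
    by rewrite addnS ltnS leq_addr.
  have := maxP (w, p3 ++ y' :: p1, p2); rewrite /= size_cat /= leqNgt.
  have -> : size p1 < size p3 + (size p1).+1 by rewrite addnS ltnS leq_addl.
  move=> h; suff: false by []; apply: h; split; last by rewrite last_cat.
  have le_i : size p1 + size p2 < size (rot i c).
    by rewrite ei /= !size_cat /= ltnS leq_add2l leq_addr.
  have : rot (size (y' :: p1 ++ p2)) (rot i c) = w :: p3 ++ y' :: p1 ++ p2.
    by rewrite ei catA -cat_cons rot_size_cat.
  move=> e2; have [j ej] : exists j, rot j c = rot (size (y' :: p1 ++ p2)) (rot i c).
    case: (leqP i (size c)) => hi; last by rewrite (rot_oversize (ltnW hi)); eexists.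
    by rewrite rot_add_mod //; [eexists | rewrite -(size_rot i c) /= size_cat].
  by exists j; rewrite ej e2 /= -catA.
case/and4P: rt => cy uy _ /allP Sy.
exists (y' :: p1 ++ [:: l]); split.
- apply/and4P; split.
  + move: cy; rewrite /= !rcons_path !cat_path !last_cat /= => /andP[/andP[-> _] _].
    by rewrite zl ly'.
  + have lyn : l \notin y' :: p1 ++ p2 by rewrite mt.
    move: uy lyn; rewrite -!cat_cons cat_uniq mem_cat negb_or => /andP[u1 _] /andP[lyn _].
    by rewrite cats1 rcons_uniq lyn.
  + by rewrite /= size_cat addn1.
  + apply/allP => z; rewrite inE mem_cat inE => /or3P[/eqP->|zp|/eqP->//]; apply: Sy.
      exact: mem_head.
    by rewrite inE mem_cat zp orbT.
- by rewrite inE mem_cat mem_head !orbT.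
- move=> z zin; rewrite -mt inE mem_cat => /or3P[/eqP->|zp|zp]; first exact: mem_head.
    by rewrite inE mem_cat zp orbT.
  by case/hasPn/(_ z zp)/negP: no2.
Qed.

Lemma cycle_through S L : semicomplete r L -> L \subset S -> 1 < #|L| ->
    {in L &, forall x y, connect (within r S) x y} ->
  exists c, ring_in r S c /\ {subset L <= c}.
Proof.
move=> sc LS gt1 con.
have [c0 [rc0 hc0]] : exists c, ring_in r S c /\ has [in L] c.
  case/card_gt1P: (gt1) => a [b [aL bL ab]].
  wlog rab : a b aL bL ab / r a b.
    by move=> h; case/orP: (sc a b aL bL ab) => rab; [apply: (h a b) | apply: (h b a); rewrite // eq_sym].
  have bS := subsetP LS b bL.
  have [p [pth lst up sub]] := connect_within (con b a bL aL) bS.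
  exists (b :: p); split; last by rewrite /= bL.
  rewrite /ring_in up /= rcons_path pth lst rab /=; apply/andP; split.
    by case: p lst {pth up sub} => //= e; rewrite e eqxx in ab.
  by apply/andP; split=> //; apply/allP => z zp; apply: sub; rewrite inE zp orbT.
have [|c [rc hc] maxc] := @ex_max_measure _ (fun c => ring_in r S c /\ has [in L] c)
    (fun c => #|[set x in L | x \in c]|) #|L| c0 (conj rc0 hc0).
  by move=> c _; apply/subset_leq_card/subsetP => x; rewrite inE => /andP[].
exists c; split=> // l lL; apply: contraT => lc.
have [c' [rc' lc' sub]] := absorb sc LS rc hc lL lc con.
have hc' : has [in L] c' by apply/hasP; exists l.
have := maxc c' (conj rc' hc'); rewrite leqNgt => /negP[].
apply/proper_card/properP; split.
  by apply/subsetP => x; rewrite !inE => /andP[xL xc]; rewrite xL sub.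
by exists l; rewrite !inE ?lL ?lc'.
Qed.
End CoverCycle.

Section Tools.
Variables (V : finType) (r : rel V).
Implicit Types (c p q : seq V) (S L : {set V}) (x y z : V).
Hypothesis irr : irreflexive r.
Hypothesis W : ore r.

(** Both [u] and [v] belong to [missed r u v], so there are at least two intermediate vertices, and
    one of them is not [t]. *)
Lemma common2 u v t : u != v -> ~~ r u v -> exists w, [/\ w != t, r u w & r w v].
Proof.
move=> uv nuv.
have : 1 < #|outs r u :&: ins r v|.
  apply: leq_trans (le_missed_common W uv nuv); apply: leq_trans (_ : #|[set u; v]| <= _).
    by rewrite cards2 uv.
  by apply/subset_leq_card/subsetP => w; rewrite !inE => /orP[] /eqP->; rewrite irr nuv.
case/card_gt1P => a [b []]; rewrite !inE => /andP[ua av] /andP[ub bv] ab.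
have [at_|] := eqVneq a t; last by exists a.
by exists b; rewrite -at_ eq_sym.
Qed.

Lemma within_mono S S' x y : S \subset S' -> connect (within r S) x y -> connect (within r S') x y.
Proof.
move=> /subsetP SS; apply: connect_sub => a b /and3P[aS bS ab].
by apply: connect1; rewrite /within !SS.
Qed.

Lemma ring_connect S c : cycle r c -> {subset c <= S} -> {in c &, forall x y, connect (within r S) x y}.
Proof.
move=> cc sub x y xc yc; apply: (@connect_cycle _ (within r S) c) => //.
apply: (@sub_in_cycle _ [in c] r) cc; last exact/allP.
by move=> a b ac bc ab; rewrite /within !sub.
Qed.

Lemma connect_arc S x y : x \in S -> y \in S -> r x y -> connect (within r S) x y.
Proof. by move=> xS yS xy; apply: connect1; rewrite /within xS yS. Qed.

Lemma dcyc_cycle c : dcyc r c -> cycle r c. Proof. by case/and3P. Qed.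

(** The last hypothesis says that [L] does not fit on a digon. *)
Lemma dcyc_through S L : semicomplete r L -> L \subset S ->
    {in L &, forall x y, connect (within r S) x y} ->
    2 < #|L| \/ (exists x y, [/\ x \in L, y \in L, x != y & ~~ r x y]) ->
  exists c, [/\ dcyc r c, {subset c <= S} & {subset L <= c}].
Proof.
move=> sc LS con big.
have [|c [/and4P[cc uc sz /allP cS] Lc]] := cycle_through sc LS _ con.
  case: big => [/ltnW //|[x [y [xL yL xy _]]]].
  by apply/card_gt1P; exists x, y.
exists c; split=> //; rewrite /dcyc cc uc /= ltn_neqAle sz andbT; apply/negP => /eqP sz2.
case: big => [gt2|[x [y [xL yL xy nxy]]]].
  suff : #|L| <= 2 by rewrite leqNgt gt2.
  by rewrite sz2 -(card_uniqP uc); apply/subset_leq_card/subsetP.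
case: c cc uc sz Lc sz2 {cS} => [|a [|b [|]]] //= /and3P[ab ba _] _ _ Lc _.
move: (Lc x xL) (Lc y yL) xy nxy; rewrite !inE.
by do 2![case/orP=> /eqP->]; rewrite ?eqxx ?ab ?ba.
Qed.
End Tools.

(** * Rerouting short cycles to cover a semicomplete set *)

Section CoverTheorem.
Variables (V : finType) (r : rel V).
Implicit Types (c p q : seq V) (S L : {set V}) (x y z : V).
Hypothesis irr : irreflexive r.
Hypothesis W : ore r.
Variable L : {set V}.
Hypothesis scL : semicomplete r L.
Variable Ts : seq (seq V).
Hypothesis shT : all (short r) Ts.
Hypothesis uT : uniq (flatten Ts).
Hypothesis large : 12 * size Ts + 3 <= #|V|.
Hypothesis Ts0 : 0 < size Ts.

Let R := [set x | x \notin flatten Ts].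
Let Z := L :&: R.

Definition covered (k : nat) := exists s, [/\ size s = k, all (dcyc r) s, uniq (flatten s)
  & {subset L <= flatten s}].

Lemma semicomplete_sub L' : L' \subset L -> semicomplete r L'.
Proof. by move=> /subsetP h x y /h xL /h yL; apply: scL. Qed.

Lemma Ts_dcyc T : T \in Ts -> dcyc r T.
Proof. by move/(allP shT) => /andP[]. Qed.

Lemma mem_R x : (x \in R) = (x \notin flatten Ts). Proof. by rewrite inE. Qed.

(** The exchange step: [cs] replaces [Told] and may use free vertices, [Tn] is kept. *)
Lemma finish Told Tn cs : perm_eq Ts (Told ++ Tn) -> size cs = size Told ->
    all (dcyc r) cs -> uniq (flatten cs) ->
    (forall x, x \in flatten cs -> x \in R \/ x \in flatten Told) ->
    (forall x, x \in L -> x \notin flatten Tn -> x \in flatten cs) -> covered (size Ts).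
Proof.
move=> pT sz dc ucs sub cov; exists (cs ++ Tn).
have pf : perm_eq (flatten Ts) (flatten Told ++ flatten Tn) by rewrite -flatten_cat perm_flatten.
have : uniq (flatten Told ++ flatten Tn) by rewrite -(perm_uniq pf).
rewrite cat_uniq => /and3P[_ disj uTn].
split.
- by rewrite size_cat sz -size_cat -(perm_size pT).
- rewrite all_cat dc; apply/allP => T TTn; apply: Ts_dcyc.
  by rewrite (perm_mem pT) mem_cat TTn orbT.
- rewrite flatten_cat cat_uniq ucs uTn andbT; apply/hasPn => x xTn; apply/negP => /sub[].
    by rewrite mem_R (perm_mem pf) mem_cat xTn orbT.
  by move=> xTo; case/hasP: disj; exists x.
- move=> x xL; rewrite flatten_cat mem_cat.
  by case: (boolP (x \in flatten Tn)) => h; rewrite ?orbT // cov.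
Qed.

(** If [R] without [Q] had no cycle, a pair as in [acyc_low_degree_pair] would have degree sum at
    most [2 (1 + 2 + 4k)], which is less than [12k + 3]. *)
Lemma spare (Q : {set V}) : #|Q| <= 2 ->
  exists c, [/\ dcyc r c, {subset c <= R} & forall x, x \in c -> x \notin Q].
Proof.
move=> Q2; apply: NNPP => nex.
have cR : #|V| <= #|R| + 4 * size Ts.
  have := cardsC [set x in flatten Ts].
  have -> : ~: [set x in flatten Ts] = R by apply/setP => x; rewrite !inE.
  have : #|[set x in flatten Ts]| <= size (flatten Ts) by rewrite cardsE card_size.
  by move: (size_flatten_short shT); lia.
have acR : acyc r (R :\: Q).
  move=> c dc sub; apply: nex; exists c; split=> // x /sub; rewrite in_setD => /andP[//].
have cRQ : 2 < #|R :\: Q|.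
  rewrite cardsD; have := subset_leq_card (subsetIr R Q).
  by move: cR Q2 large Ts0; clear; lia.
have [u [v [uR vR uv nuv [du dv]]]] := acyc_low_degree_pair irr acR cRQ.
have bound (A : {set V}) : #|A| <= #|[set w in R :\: Q | w \in A]| + 2 + 4 * size Ts.
  have : #|A| <= #|[set w in R :\: Q | w \in A] :|: (Q :|: [set x in flatten Ts])|.
    apply/subset_leq_card/subsetP => w wA; rewrite in_setU in_setU inE wA andbT in_setD mem_R inE.
    by case: (w \in Q); case: (w \in flatten Ts); rewrite ?orbT.
  have := (leq_card_setU [set w in R :\: Q | w \in A] (Q :|: [set x in flatten Ts])).1.
  have := (leq_card_setU Q [set x in flatten Ts]).1.
  have : #|[set x in flatten Ts]| <= size (flatten Ts) by rewrite cardsE card_size.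
  by move: (size_flatten_short shT) Q2; clear; lia.
have := W uv nuv; move: (bound (outs r u)) (bound (ins r v)).
have -> : [set w in R :\: Q | w \in outs r u] = [set w in R :\: Q | r u w].
  by apply/setP => w; rewrite !inE.
have -> : [set w in R :\: Q | w \in ins r v] = [set w in R :\: Q | r w v].
  by apply/setP => w; rewrite !inE.
by move: du dv large Ts0; clear; lia.
Qed.

Lemma Ts_not_R (Told : seq (seq V)) x : {subset Told <= Ts} -> x \in flatten Told -> x \notin R.
Proof.
move=> sub /flattenP[T /sub TT xT]; rewrite mem_R negbK.
by apply/flattenP; exists T.
Qed.

(** Since [g] meets every cycle of [Told], their union is strongly connected, and a cycle through
    its vertices of [L] in [Z] or [Told] exists. The second alternative is the only obstruction:
    these vertices form a digon with one end off [g]. *)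
Lemma merge z g Told : z \in Z -> dcyc r g -> {subset Z <= g} -> {subset Told <= Ts} ->
    (forall T, T \in Told -> has [in g] T) ->
  (exists c, [/\ dcyc r c, forall x, x \in c -> (x \in g) || (x \in flatten Told),
      {subset Z <= c} & forall x, x \in L -> x \in flatten Told -> x \in c]) \/
  (exists z l, [/\ Z = [set z], l \notin g, r z l & r l z] /\
     [/\ l \in L, l \in flatten Told & forall x, x \in L -> x \in flatten Told -> x = l]).
Proof.
move=> zZ dg Zg Tsub hit.
pose S := [set x | (x \in g) || (x \in flatten Told)].
pose L' := [set x in L | (x \in Z) || (x \in flatten Told)].
have L'L : L' \subset L by apply/subsetP => x; rewrite inE => /andP[].
have L'S : L' \subset S.
  by apply/subsetP => x; rewrite !inE => /andP[_ /orP[xZ|->]]; rewrite ?orbT // Zg // !inE.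
have gS : {subset g <= S} by move=> x xg; rewrite inE xg.
have conG x : x \in S -> exists y, [/\ y \in g, connect (within r S) x y & connect (within r S) y x].
  rewrite inE => /orP[xg|/flattenP[T TT xT]]; first by exists x.
  have /hasP[y yT yg] := hit T TT.
  have TS : {subset T <= S} by move=> w wT; rewrite inE; apply/orP; right; apply/flattenP; exists T.
  by exists y; split=> //; apply: (ring_connect _ TS) => //; apply/dcyc_cycle/Ts_dcyc/Tsub.
have con : {in L' &, forall x y, connect (within r S) x y}.
  move=> x y /(subsetP L'S) /conG[x' [x'g xx' _]] /(subsetP L'S) /conG[y' [y'g _ y'y]].
  apply: connect_trans xx' (connect_trans _ y'y).
  exact: (ring_connect (dcyc_cycle dg) gS).
have fin c : dcyc r c -> {subset c <= S} -> {subset L' <= c} ->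
  (exists c, [/\ dcyc r c, forall x, x \in c -> (x \in g) || (x \in flatten Told),
      {subset Z <= c} & forall x, x \in L -> x \in flatten Told -> x \in c]).
  move=> dc cS Lc; exists c; split=> // [x /cS|x xZ|x xL xT]; first by rewrite inE.
    by apply: Lc; rewrite inE xZ andbT; move: xZ; rewrite inE => /andP[].
  by apply: Lc; rewrite inE xL xT orbT.
have [sub|/subsetPn[l lL' lg]] := boolP (L' \subset [set x in g]).
  left; apply: (fin g dg gS) => x /(subsetP sub); rewrite inE.
  by [].
have [big|nbig] := classic (2 < #|L'| \/ (exists x y, [/\ x \in L', y \in L', x != y & ~~ r x y])).
  by have [c [dc cS Lc]] := dcyc_through (semicomplete_sub L'L) L'S con big; left; apply: (fin c).
have le2 : #|L'| <= 2 by rewrite leqNgt; apply/negP => h; apply: nbig; left.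
have adj x y : x \in L' -> y \in L' -> x != y -> r x y.
  by move=> xL yL xy; apply: contraT => nxy; case: nbig; right; exists x, y.
rewrite inE in lg; have [lL lT] : l \in L /\ l \in flatten Told.
  move: lL'; rewrite inE => /andP[-> /orP[lZ|//]].
  by rewrite Zg in lg.
have ZL' x : x \in Z -> x \in L'.
  by move=> xZ; rewrite inE xZ andbT; move: xZ; rewrite inE => /andP[].
have zl : z != l by apply: contraNneq lg => <-; apply: Zg.
have two x : x \in L' -> x = z \/ x = l.
  move=> xL'; have [|xz] := eqVneq x z; first by left.
  have [|xl] := eqVneq x l; first by right.
  move: le2; rewrite leqNgt; case/negP; apply/card_gt2P; exists x, z, l.
  by split; split; rewrite // ?ZL' // eq_sym.
right; exists z, l; split; split=> //.
- apply/setP => x; rewrite in_set1; apply/idP/eqP => [xZ|->//].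
  by have [//|e] := two x (ZL' x xZ); rewrite -e Zg in lg.
- by apply: adj => //; apply: ZL'.
- by apply: adj; rewrite 1?eq_sym //; apply: ZL'.
- move=> x xL xT; have [|e|//] := two x; first by rewrite inE xL xT orbT.
  by move: (Ts_not_R Tsub xT); rewrite e; move: zZ; rewrite inE => /andP[_ ->].
Qed.

(* The exceptional case of [merge]: the cycle [z l] of length two is replaced
   by a path of arcs through the rest of [T]. *)
Lemma finish_digon z l T : Z = [set z] -> T \in Ts -> l \in T -> l \in L ->
    (forall x, x \in L -> x \in T -> x = l) -> r z l -> r l z -> covered (size Ts).
Proof.
move=> Zz TT lT lL only zl lz.
have zL : z \in L by have : z \in Z by [rewrite Zz inE]; rewrite inE => /andP[].
have zR : z \in R by have : z \in Z by [rewrite Zz inE]; rewrite inE => /andP[].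
have pT : perm_eq Ts ([:: T] ++ rem T Ts) by apply: perm_to_rem.
have sub1 : {subset [:: T] <= Ts} by move=> T'; rewrite inE => /eqP->.
have zT : z \notin T.
  by apply/negP => zT; move: (Ts_not_R sub1 (x := z)); rewrite /= cats0 zT zR => /(_ isT).
have pf : perm_eq (flatten Ts) (T ++ flatten (rem T Ts)) by have := perm_flatten pT; rewrite /= .
have LT x : x \in L -> x \notin flatten (rem T Ts) -> x = z \/ x = l.
  move=> xL xn; have [xT|xT] := boolP (x \in flatten Ts).
    by right; apply: only => //; move: xT; rewrite (perm_mem pf) mem_cat (negPf xn) orbF.
  by left; apply/eqP; rewrite -in_set1 -Zz inE xL mem_R.
have one c : dcyc r c -> z \in c -> l \in c -> (forall x, x \in c -> x \in T \/ x = z) ->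
    covered (size Ts).
  move=> dc zc lc cT; apply: (finish (cs := [:: c]) pT) => //=; rewrite ?dc ?cats0 //.
  - exact: dcyc_uniq dc.
  - by move=> x /cT[xT|->]; [right | left].
  - by move=> x xL xn; case: (LT x xL xn) => ->.
have [i t et] := rot_to lT.
have dT : dcyc r (l :: t) by rewrite -et /dcyc rot_cycle rot_uniq size_rot; apply: Ts_dcyc.
have mt x : (x \in l :: t) = (x \in T) by rewrite -et mem_rot.
case: t => [|c2 t] in et dT mt *; first by case/and3P: dT.
have ut : uniq [:: l, c2 & t] by apply: dcyc_uniq dT.
have c2T : c2 \in T by rewrite -mt !inE eqxx orbT.
have zc2 : z != c2 by apply: contraNneq zT => ->.
have lstl : r (last c2 t) l.
  by case/and3P: dT; rewrite /= rcons_path => /andP[_ /andP[_ ->]].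
have [lc2 pth] : r l c2 /\ path r c2 t.
  by case/and3P: dT; rewrite /= rcons_path => /andP[-> /andP[-> _]].
have znt : z \notin [:: l, c2 & t] by rewrite mt.
(* From [z -> y] one continues along [T] to [l] and back to [z]; for [y -> z] one takes [z -> l] and
   follows [T] to [y]. *)
have via y : y \in T -> y != l -> r z y || r y z -> covered (size Ts).
  move=> yt yl yz; have yin : y \in c2 :: t by have := mt y; rewrite inE (negPf yl) yt /= => ->.
  have [p1 [p2 ey]] : exists p1 p2, c2 :: t = p1 ++ y :: p2.
    by case/splitPr: yin => p1 p2; exists p1, p2.
  move: dT ut znt mt; rewrite ey => dT ut znt mt.
  case/orP: yz => rzy.
    apply: (one [:: z, y & rcons p2 l]).
    - have u : uniq [:: z, l, y & p2].
        have : uniq ([:: z; l] ++ p1 ++ y :: p2) by rewrite /= in znt ut *; rewrite znt.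
        by apply: (@subseq_uniq _ ([:: z; l] ++ y :: p2)); rewrite subseq_cat2l suffix_subseq.
      have pu : perm_eq [:: z, y & rcons p2 l] [:: z, l, y & p2].
        by rewrite perm_cons -rcons_cons perm_rcons.
      rewrite /dcyc (perm_uniq pu) u /= size_rcons andbT rzy rcons_path last_rcons lz andbT.
      by case/and3P: dT => + _ _; rewrite /= rcons_cat cat_path /= => /and3P[_ _ ->].
    - exact: mem_head.
    - by rewrite !inE mem_rcons mem_head !orbT.
    - move=> x; rewrite inE -rcons_cons mem_rcons inE => /or3P[/eqP->|/eqP->|xp]; [by right|by left|].
      by left; rewrite -mt inE mem_cat xp !orbT.
  apply: (one [:: z, l & rcons p1 y]).
  - have : uniq [:: z, l & p1 ++ y :: p2] by rewrite cons_uniq znt.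
    rewrite -cat_rcons -!cat_cons cat_uniq => /andP[u _].
    rewrite /dcyc u /= size_rcons andbT zl rcons_path last_rcons rzy andbT.
    by move/dcyc_cycle: dT; rewrite /= -cat_rcons rcons_cat cat_path => /andP[-> _].
  - exact: mem_head.
  - by rewrite !inE eqxx orbT.
  - move=> x; rewrite inE => /orP[/eqP->|xp]; [by right|left].
    by rewrite -mt -cat_rcons -cat_cons mem_cat xp.
have c2l : c2 != l by move: ut; rewrite /= inE negb_or eq_sym => /andP[/andP[]].
have nzy y : y \in T -> y != l -> ~~ r z y && ~~ r y z \/ covered (size Ts).
  move=> yT yl; rewrite -negb_or; case: (boolP (r z y || r y z)) => h; last by left.
  by right; apply: via h.
(* Now [z] has no arcs to or from the rest of [T], so an intermediate vertex [w] between [z] and the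
   successor [c2] of [l] lies outside [T], and [z], [w] and all of [T] form a cycle. *)
have [|//] := nzy c2 c2T c2l; case/andP=> nzc _.
have [w [wl zw wc]] := common2 irr W l zc2 nzc.
have [wT|wT] := boolP (w \in T).
  by have [|//] := nzy w wT wl; rewrite zw.
have dg : dcyc r [:: z, w, c2 & rcons t l].
  have zw' : z != w by apply: contraTneq zw => ->; rewrite irr.
  have pu : perm_eq (c2 :: rcons t l) [:: l, c2 & t] by rewrite -rcons_cons perm_rcons.
  apply/and3P; split; last by rewrite /= size_rcons.
    by rewrite /= !rcons_path last_rcons zw wc pth lstl lz.
  by rewrite cons_uniq cons_uniq (perm_uniq pu) ut inE negb_or zw' !(perm_mem pu) znt mt wT.
have gT x : x \in [:: z, w, c2 & rcons t l] -> [\/ x = z, x = w | x \in T].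
  rewrite 2!inE -rcons_cons mem_rcons mt => /or3P[/eqP|/eqP|]; by [constructor 1|constructor 2|constructor 3].
have lg : l \in [:: z, w, c2 & rcons t l] by rewrite !inE mem_rcons mem_head !orbT.
have zg := mem_head z [:: w, c2 & rcons t l].
move: dg gT lg zg; set g := [:: _, _, _ & _] => dg gT lg zg.
have wg : w \in g by rewrite !inE eqxx orbT.
have [wR|wnR] := boolP (w \in R).
  apply: (finish (cs := [:: g]) pT) => //=; rewrite ?dg ?cats0 //.
  - exact: dcyc_uniq dg.
  - by move=> x /gT[->|->|xT]; [left|left|right].
  - by move=> x xL xn; case: (LT x xL xn) => ->.
have {}wnR : w \in flatten (rem T Ts).
  by move: wnR; rewrite mem_R negbK (perm_mem pf) mem_cat (negPf wT).
have [T2 T2r wT2] := flattenP wnR.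
have pT2 : perm_eq Ts ([:: T; T2] ++ rem T2 (rem T Ts)).
  by rewrite (perm_trans pT) //= perm_cons perm_to_rem.
have sub2 : {subset [:: T; T2] <= Ts}.
  by move=> T'; rewrite !inE (perm_mem pT) /= inE => /orP[/eqP->|/eqP->]; rewrite ?eqxx ?T2r ?orbT.
have Zg : {subset Z <= g} by move=> x; rewrite Zz inE => /eqP->.
have zZ : z \in Z by rewrite Zz inE.
have hit : forall T', T' \in [:: T; T2] -> has [in g] T'.
  by move=> T'; rewrite !inE => /orP[]/eqP->; apply/hasP; [exists l|exists w].
(* The vertex [w] lies on another cycle [T2]: both [T] and [T2] merge with [g], and [D] restores the
   count. The digon alternative cannot recur because [l] is on [g]. *)
have [|D [dD DR DQ]] := spare (Q := [set z]); first by rewrite cards1.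
have [[c [dc csub Zc Lc]]|[z' [l' [[_ l'g _ _] [l'L l'T' only']]]]] := merge zZ dg Zg sub2 hit; last first.
  by rewrite -(only' l lL _) ?lg // in l'g; rewrite /= mem_cat lT.
have TR x : x \in flatten [:: T; T2] -> x \notin R by apply: Ts_not_R.
have gR x : x \in g -> x \in R -> x = z.
  move=> /gT[-> //|->|xT]; first by move=> wR; have := TR w; rewrite wR /= cats0 mem_cat wT2 orbT => /(_ isT).
  by move=> xR; have := TR x; rewrite xR /= mem_cat xT => /(_ isT).
have cR x : x \in c -> x \in R -> x = z.
  by move=> /csub/orP[/gR//|/TR xR xR']; rewrite xR' in xR.
apply: (finish (cs := [:: c; D]) pT2) => //.
- by rewrite /= dc dD.
- rewrite /= cats0 cat_uniq (dcyc_uniq dc) (dcyc_uniq dD) andbT; apply/hasPn => x xD.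
  by apply/negP => xc; have := DQ x xD; rewrite (cR x xc (DR x xD)) inE eqxx.
- move=> x; rewrite /= cats0 mem_cat => /orP[/csub/orP[/gT[->|->|xT]|xT]|/DR]; auto.
  + by right; rewrite /= cats0 mem_cat wT2 orbT.
  + by right; rewrite /= mem_cat xT.
- move=> x xL xn; rewrite /= mem_cat.
  have [xT|xT] := boolP (x \in flatten Ts); last by rewrite Zc // inE xL mem_R.
  rewrite Lc //; move: xT; rewrite (perm_mem (perm_flatten pT2)) flatten_cat mem_cat.
  by rewrite (negPf xn) orbF.
Qed.

(** Merging two cycles with [g] loses one, which [spare] makes up for; it can avoid only two
    vertices, hence the bound on the free vertices of [g]. *)
Lemma finish_hit z g Told Tn : z \in Z -> dcyc r g -> {subset Z <= g} ->
    perm_eq Ts (Told ++ Tn) -> (forall T, T \in Told -> has [in g] T) ->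
    (forall x, x \in g -> x \in R \/ x \in flatten Told) ->
    size Told = 1 \/ size Told = 2 /\ count [in R] g <= 2 -> covered (size Ts).
Proof.
move=> zZ dg Zg pT hit gS small.
have Tsub : {subset Told <= Ts} by move=> T TT; rewrite (perm_mem pT) mem_cat TT.
have inT x : x \in flatten Ts -> x \notin flatten Tn -> x \in flatten Told.
  by rewrite (perm_mem (perm_flatten pT)) flatten_cat mem_cat => /orP[//|->].
have [[c [dc csub Zc Lc]]|[z' [l [[Zz lg zl lz] [lL /flattenP[T TT lT] only]]]]] := merge zZ dg Zg Tsub hit; last first.
  apply: (finish_digon Zz (Tsub T TT) lT lL _ zl lz) => x xL xT.
  by apply: only => //; apply/flattenP; exists T.
have cov x : x \in L -> x \notin flatten Tn -> x \in c.
  move=> xL xn; have [/inT/(_ xn) xT|xT] := boolP (x \in flatten Ts); first exact: Lc.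
  by apply: Zc; rewrite inE xL mem_R.
have cS x : x \in c -> x \in R \/ x \in flatten Told.
  by move=> /csub/orP[/gS|]; auto.
case: small => [s1|[s2 g2]].
  apply: (finish (cs := [:: c]) pT) => //=; rewrite ?s1 ?dc ?cats0 //.
  exact: dcyc_uniq dc.
have [|D [dD DR DQ]] := spare (Q := [set x in g | x \in R]).
  apply: leq_trans g2; rewrite -size_filter; apply: leq_trans (card_size _).
  by apply/subset_leq_card/subsetP => x; rewrite inE mem_filter /= andbC.
apply: (finish (cs := [:: c; D]) pT) => //=; rewrite ?s2 ?dc ?dD ?cats0 //.
- rewrite cat_uniq (dcyc_uniq dc) (dcyc_uniq dD) andbT; apply/hasPn => x xD.
  apply/negP => /csub/orP[xg|/(Ts_not_R Tsub)]; last by rewrite DR.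
  by have := DQ x xD; rewrite inE xg DR.
- by move=> x; rewrite mem_cat => /orP[/cS|/DR]; auto.
- by move=> x xL xn; rewrite mem_cat cov.
Qed.

(* If no cycle of [Ts] can be merged with [g], each of them is a sink or a source
   relative to [Z]; some arc leads from a sink [Tm] to a source [Ti], and
   [Z -> Tm -> Ti -> Z] closes up. *)
Lemma finish_free z g : z \in Z -> dcyc r g -> {subset Z <= g} -> {subset g <= R} ->
  covered (size Ts).
Proof.
move=> zZ dg Zg gR.
have rem1 T : T \in Ts -> perm_eq Ts ([:: T] ++ rem T Ts) by apply: perm_to_rem.
have inL1 T x : T \in Ts -> x \in L -> x \notin flatten (rem T Ts) -> x \in Z \/ x \in T.
  move=> TT xL xn; have [xT|xT] := boolP (x \in flatten Ts); last by left; rewrite inE xL mem_R.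
  move: xT; rewrite (perm_mem (perm_flatten (rem1 T TT))) flatten_cat mem_cat (negPf xn) orbF.
  by rewrite /= cats0; right.
have [[T TT T0]|meets] := classic (exists2 T, T \in Ts & forall x, x \in L -> x \notin T).
  apply: (finish (cs := [:: g]) (rem1 T TT)) => //=; rewrite ?dg ?cats0 //.
  - exact: dcyc_uniq dg.
  - by move=> x /gR; left.
  - by move=> x xL xn; have [/Zg //|] := inL1 T x TT xL xn; rewrite (negPf (T0 x xL)).
have {}meets T : T \in Ts -> exists l, l \in L /\ l \in T.
  move=> TT; apply: NNPP => nex; apply: meets; exists T => // x xL.
  by apply/negP => xT; apply: nex; exists x.
pose SR (T : seq V) := R :|: [set x in T].
pose conn T := connect (within r (SR T)).
have ZR x : x \in Z -> x \in R by rewrite inE => /andP[].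
have ZL x : x \in Z -> x \in L by rewrite inE => /andP[].
have RS T : R \subset SR T by apply: subsetUl.
have TS T : {subset T <= SR T} by move=> x xT; rewrite !inE xT orbT.
have Tnot T x : T \in Ts -> x \in T -> x \notin R.
  by move=> TT xT; rewrite mem_R negbK; apply/flattenP; exists T.
have conZ T x y : x \in Z -> y \in Z -> conn T x y.
  move=> xZ yZ; apply: (ring_connect (c := g)); rewrite ?Zg //; first exact: dcyc_cycle.
  by move=> w /gR; apply/subsetP.
have conT T x y : T \in Ts -> x \in T -> y \in T -> conn T x y.
  by move=> TT xT yT; apply: (ring_connect (dcyc_cycle (Ts_dcyc TT)) (TS T)).
pose snk (T : seq V) := forall x y, x \in T -> y \in Z -> ~~ conn T x y.
pose src (T : seq V) := forall x y, x \in Z -> y \in T -> ~~ conn T x y.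
(* If [Z] and [T] reach each other within [R] and [T], one cycle covers the vertices of [L] in both
   and replaces [T]; the digon case is [finish_digon]. *)
have snk_src T : T \in Ts -> snk T \/ src T \/ covered (size Ts).
  move=> TT; have [|ns] := classic (snk T); [by left|right].
  have [|nc] := classic (src T); [by left|right].
  have toZ x y : x \in T -> y \in Z -> conn T x y.
    move=> xT yZ; apply: contraT => nxy; case: ns => a b aT bZ; apply: contra nxy => ab.
    exact: connect_trans (conT T x a TT xT aT) (connect_trans ab (conZ T b y bZ yZ)).
  have frZ x y : x \in Z -> y \in T -> conn T x y.
    move=> xZ yT; apply: contraT => nxy; case: nc => a b aZ bT; apply: contra nxy => ab.
    exact: connect_trans (conZ T x a xZ aZ) (connect_trans ab (conT T b y TT bT yT)).
  pose L' := [set x in L | (x \in Z) || (x \in T)].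
  have L'S : L' \subset SR T.
    apply/subsetP => x; rewrite [x \in L']inE => /andP[_ /orP[/ZR|/TS //]].
    exact/subsetP.
  have L'L : L' \subset L by apply/subsetP => x; rewrite inE => /andP[].
  have [l [lL lT]] := meets T TT.
  have con : {in L' &, forall x y, connect (within r (SR T)) x y}.
    move=> x y; rewrite [x \in L']inE [y \in L']inE => /andP[_ /orP[xZ|xT]] /andP[_ /orP[yZ|yT]].
    - exact: conZ.
    - exact: frZ.
    - exact: toZ.
    - exact: conT.
  have zL' : z \in L' by rewrite inE ZL ?zZ.
  have lL' : l \in L' by rewrite inE lL lT orbT.
  have zl : z != l by apply: contraTneq (ZR z zZ) => ->; apply: Tnot lT.
  have [big|nbig] := classic (2 < #|L'| \/ (exists x y, [/\ x \in L', y \in L', x != y & ~~ r x y])).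
    have [c [dc cS L'c]] := dcyc_through (semicomplete_sub L'L) L'S con big.
    apply: (finish (cs := [:: c]) (rem1 T TT)) => //=; rewrite ?dc ?cats0 //.
    + exact: dcyc_uniq dc.
    + by move=> x /cS; rewrite in_setU => /orP[|]; [left | rewrite inE; right].
    + move=> x xL xn; apply: L'c; rewrite inE xL.
      by case: (inL1 T x TT xL xn) => ->; rewrite ?orbT.
  have two x : x \in L' -> x = z \/ x = l.
    move=> xL'; have [|xz] := eqVneq x z; first by left.
    have [|xl] := eqVneq x l; first by right.
    by case: nbig; left; apply/card_gt2P; exists x, z, l; split; split; rewrite // eq_sym.
  have adj x y : x \in L' -> y \in L' -> x != y -> r x y.
    by move=> xL yL xy; apply: contraT => nxy; case: nbig; right; exists x, y.
  apply: (@finish_digon z l T) => //; last 2 first.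
  - exact: adj.
  - by apply: adj; rewrite // eq_sym.
  - apply/setP => x; rewrite in_set1; apply/idP/eqP => [xZ|->//].
    have [|//|e] := two x; first by rewrite inE ZL ?xZ.
    by move: (Tnot T l TT lT) (ZR x xZ); rewrite e => /negPf->.
  - move=> x xL xT; have [|e|//] := two x; first by rewrite inE xL xT orbT.
    by move: (Tnot T x TT xT); rewrite e ZR.
have Tarc T x t : T \in Ts -> x \in T -> t \in R -> r x t -> conn T x t.
  by move=> TT xT tR; apply: connect_arc; [apply: TS | apply: (subsetP (RS T))].
have arcT T x t : T \in Ts -> x \in T -> t \in R -> r t x -> conn T t x.
  by move=> TT xT tR; apply: connect_arc; [apply: (subsetP (RS T)) | apply: TS].
have zR := ZR z zZ.
have rcon T x y : T \in Ts -> x \in R -> y \in T -> r x y -> conn T x y.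
  by move=> TT xR yT; apply: arcT.
(* For a vertex [l] of [L] on [T], the arc between [l] and [z] in the forbidden direction is absent,
   so an intermediate vertex [t] exists. It cannot be free, and its cycle must be of the opposite
   kind to [T]. *)
have key : covered (size Ts) \/ exists Tm Ti a b, [/\ Tm \in Ts, Ti \in Ts, Ti != Tm, snk Tm /\ src Ti &
    [/\ a \in Tm, b \in Ti & r a b]].
  have [T TT] : exists T, T \in Ts by case: (Ts) Ts0 => // T s _; exists T; apply: mem_head.
  have [l [lL lT]] := meets T TT.
  have zl : z != l by apply: contraTneq zR => ->; apply: Tnot lT.
  have [sk|[sc|]] := snk_src T TT; last by left.
    have nlz : ~~ r l z by apply: contra (sk l z lT zZ); apply: Tarc.
    have lz : l != z by rewrite eq_sym.
    have [t [_ lt tz]] := common2 irr W l lz nlz.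
    have [tR|] := boolP (t \in R).
      case/negP: (sk l z lT zZ); apply: connect_trans (Tarc T l t TT lT tR lt) _.
      by apply: connect_arc tz; apply: (subsetP (RS T)).
    rewrite mem_R negbK => /flattenP[Ti Tis tTi].
    have [si|[si|]] := snk_src Ti Tis; last by left.
      by case/negP: (si t z tTi zZ); apply: Tarc.
    right; exists T, Ti, l, t; split=> //.
    by apply/eqP => e; rewrite e in tTi; case/negP: (sk t z tTi zZ); apply: Tarc.
  have nzl : ~~ r z l by apply: contra (sc z l zZ lT); apply: arcT.
  have [t [_ zt tl]] := common2 irr W l zl nzl.
  have [tR|] := boolP (t \in R).
    case/negP: (sc z l zZ lT); apply: connect_trans (arcT T l t TT lT tR tl).
    by apply: connect_arc zt; apply: (subsetP (RS T)).
  rewrite mem_R negbK => /flattenP[Ti Tis tTi].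
  have [si|[si|]] := snk_src Ti Tis; last by left.
    right; exists Ti, T, t, l; split=> //.
    by apply/eqP => e; rewrite -e in tTi; case/negP: (sc z t zZ tTi); apply: arcT.
  by case/negP: (si z t zZ tTi); apply: arcT.
case: key => // [[Tm [Ti [a [b [Tms Tis Tim [sm si] [aT bT ab]]]]]]].
have [lm [lmL lmT]] := meets Tm Tms; have [li [liL liT]] := meets Ti Tis.
have pT2 : perm_eq Ts ([:: Tm; Ti] ++ rem Ti (rem Tm Ts)).
  rewrite (perm_trans (rem1 Tm Tms)) //= perm_cons perm_to_rem //.
  by have := Tis; rewrite (perm_mem (rem1 Tm Tms)) /= inE (negPf Tim).
have sub2 : {subset [:: Tm; Ti] <= Ts} by move=> T'; rewrite !inE => /orP[] /eqP->.
have [|D [dD DR DQ]] := spare (Q := [set z]); first by rewrite cards1.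
(* The spare cycle [D] offsets the merging of [Tm] with [Ti]. It may itself contain vertices of [Z],
   so the merged cycle only has to cover the others. *)
pose B := [set x | (x \in Z) && (x \notin D)].
have zB : z \in B.
  by rewrite [_ \in B]inE zZ; apply/negP => /DQ; rewrite inE eqxx.
have BZ x : x \in B -> x \in Z by rewrite inE => /andP[].
pose S := B :|: [set x in Tm ++ Ti].
pose L' := [set x in L | x \in S].
have L'S : L' \subset S by apply/subsetP => x; rewrite [_ \in L']inE => /andP[].
have L'L : L' \subset L by apply/subsetP => x; rewrite inE => /andP[].
have inS x : x \in S -> [\/ x \in B, x \in Tm | x \in Ti].
  by rewrite in_setU [x \in [set _ in _]]inE mem_cat => /or3P[]; by [constructor 1|constructor 2|constructor 3].
have BS x : x \in B -> x \in S by move=> xB; rewrite in_setU xB.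
have mS : {subset Tm <= S} by move=> x xT; rewrite in_setU [x \in [set _ in _]]inE mem_cat xT orbT.
have iS : {subset Ti <= S} by move=> x xT; rewrite in_setU [x \in [set _ in _]]inE mem_cat xT !orbT.
have Tneq T x y : T \in Ts -> x \in T -> y \in Z -> x != y.
  by move=> TT xT yZ; apply: contraTneq (ZR y yZ) => <-; apply: Tnot xT.
have Zm x : x \in Z -> r x lm.
  move=> xZ; have := scL lmL (ZL x xZ) (Tneq Tm lm x Tms lmT xZ).
  case/orP=> // h; case/negP: (sm lm x lmT xZ); apply: Tarc => //; exact: ZR.
have iZ x : x \in Z -> r li x.
  move=> xZ; have := scL liL (ZL x xZ) (Tneq Ti li x Tis liT xZ).
  case/orP=> // h; case/negP: (si x li xZ liT); apply: arcT => //; exact: ZR.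
pose con := connect (within r S).
have cm x y : x \in Tm -> y \in Tm -> con x y.
  by apply: ring_connect mS x y; apply/dcyc_cycle/Ts_dcyc.
have ci x y : x \in Ti -> y \in Ti -> con x y.
  by apply: ring_connect iS x y; apply/dcyc_cycle/Ts_dcyc.
have toz x : x \in S -> con x z.
  have fromi y : y \in Ti -> con y z.
    move=> yT; apply: connect_trans (ci y li yT liT) _.
    by apply: connect_arc; [apply: iS|apply: BS|apply: iZ].
  have fromm y : y \in Tm -> con y z.
    move=> yT; apply: connect_trans (cm y a yT aT) (connect_trans _ (fromi b bT)).
    by apply: connect_arc; [apply: mS|apply: iS|].
  move=> xS; case/inS: (xS) => [xB|/fromm //|/fromi //].
  apply: connect_trans (fromm lm lmT); apply: connect_arc => //; [exact: mS|exact/Zm/BZ].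
have frz x : x \in S -> con z x.
  have tom y : y \in Tm -> con z y.
    move=> yT; apply: connect_trans (cm lm y lmT yT).
    by apply: connect_arc; [apply: BS|apply: mS|apply: Zm].
  have toi y : y \in Ti -> con z y.
    move=> yT; apply: connect_trans (tom a aT) (connect_trans _ (ci b y bT yT)).
    by apply: connect_arc; [apply: mS|apply: iS|].
  move=> xS; case/inS: (xS) => [xB|/tom //|/toi //].
  apply: connect_trans (toi li liT) _; apply: connect_arc => //; [exact: iS|exact/iZ/BZ].
have [||c [dc cS L'c]] := dcyc_through (semicomplete_sub L'L) L'S.
- move=> x y /(subsetP L'S) xS /(subsetP L'S) yS; exact: connect_trans (toz x xS) (frz y yS).
- left; apply/card_gt2P; exists z, lm, li; split; split.
  + by rewrite inE ZL ?BS.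
  + by rewrite inE lmL mS.
  + by rewrite inE liL iS.
  + by rewrite eq_sym; apply: Tneq lmT zZ.
  + by apply/eqP => e; case/negP: (si z li zZ liT); apply: arcT => //; rewrite -e; apply: Zm.
  + exact: Tneq liT zZ.
have flT : flatten [:: Tm; Ti] = Tm ++ Ti by rewrite /= cats0.
apply: (finish (cs := [:: c; D]) pT2) => //.
- by rewrite /= dc dD.
- rewrite /= cats0 cat_uniq (dcyc_uniq dc) (dcyc_uniq dD) andbT; apply/hasPn => x xD.
  apply/negP => /cS/inS[|xT|xT]; first by rewrite [_ \in B]inE xD andbF.
    by move: (Tnot Tm x Tms xT); rewrite DR.
  by move: (Tnot Ti x Tis xT); rewrite DR.
- move=> x; rewrite flT /= cats0 !mem_cat => /orP[/cS/inS[/BZ/ZR|->|->]|/DR]; rewrite ?orbT; auto.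
- move=> x xL xn; rewrite /= cats0 mem_cat.
  have [xD|xD] := boolP (x \in D); first by rewrite orbT.
  have [xT|xT] := boolP (x \in flatten Ts); last first.
    have xZ : x \in Z by rewrite inE xL mem_R.
    by rewrite L'c // inE xL BS // inE xZ xD.
  move: xT; rewrite (perm_mem (perm_flatten pT2)) flatten_cat flT mem_cat (negPf xn) orbF => xT.
  by rewrite L'c // inE xL in_setU [x \in [set _ in _]]inE xT orbT.
Qed.

(** The alternatives match [finish_hit]: a cycle with one vertex off [R] meets at most one cycle of
    [Ts], and one with two such vertices must leave enough of [R] for a spare cycle. *)
Lemma exists_cycle_near z : z \in Z -> exists g, [/\ dcyc r g, {subset Z <= g} &
  (exists t, forall x, x \in g -> x \in R \/ x = t) \/
  (exists t t', (forall x, x \in g -> [\/ x \in R, x = t | x = t']) /\ count [in R] g <= 2)].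
Proof.
move=> zZ.
have ZR x : x \in Z -> x \in R by rewrite inE => /andP[].
have ZL x : x \in Z -> x \in L by rewrite inE => /andP[].
have ZsR : Z \subset R by apply/subsetP.
have ZsL : Z \subset L by apply/subsetP.
pose con := connect (within r R).
have con0 x : con x x by apply: connect0.
have arc x y : x \in Z -> y \in Z -> r x y -> con x y.
  by move=> /ZR xR /ZR yR; apply: connect_arc.
have [all_con|ncon] := classic ({in Z &, forall x y, con x y}); last first.
  (* By semicompleteness, the vertex reached from most of [Z] is reached from all of [Z]; dually [f]
     reaches all of [Z]. As [e] does not reach [f], one intermediate vertex [t] makes everything
     strongly connected. *)
  have [|e eZ maxe] := @ex_max_measure _ (fun x => x \in Z) (fun x => #|[set y in Z | con y x]|) #|V| z zZ.
    by move=> *; apply: max_card.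
  have toe y : y \in Z -> con y e.
    move=> yZ; apply: contraT => nye; have ye : y != e.
      by apply: contraNneq nye => ->; apply: connect0.
    have nr : ~~ r y e by apply: contra nye; apply: arc.
    have := scL (ZL y yZ) (ZL e eZ) ye; rewrite (negPf nr) => /= rey.
    have := maxe y yZ; rewrite leqNgt => /negP[]; apply/proper_card/properP; split.
      apply/subsetP => x; rewrite inE [x \in [set _ in _ | _]]inE => /andP[-> xe] /=.
      exact: connect_trans xe (arc e y eZ yZ rey).
    by exists y; rewrite inE yZ ?con0 // (negPf nye).
  have [|f fZ maxf] := @ex_max_measure _ (fun x => x \in Z) (fun x => #|[set y in Z | con x y]|) #|V| z zZ.
    by move=> *; apply: max_card.
  have frf y : y \in Z -> con f y.
    move=> yZ; apply: contraT => nye; have ye : y != f.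
      by apply: contraNneq nye => ->; apply: connect0.
    have nr : ~~ r f y by apply: contra nye; apply: arc.
    have := scL (ZL y yZ) (ZL f fZ) ye; rewrite (negPf nr) orbF => /= rey.
    have := maxf y yZ; rewrite leqNgt => /negP[]; apply/proper_card/properP; split.
      apply/subsetP => x; rewrite inE [x \in [set _ in _ | _]]inE => /andP[-> xe] /=.
      exact: connect_trans (arc y f yZ fZ rey) xe.
    by exists y; rewrite inE yZ ?con0 // (negPf nye).
  have nef : ~~ con e f.
    apply/negP => ef; apply: ncon => x y xZ yZ.
    exact: connect_trans (toe x xZ) (connect_trans ef (frf y yZ)).
  have e_f : e != f by apply: contraNneq nef => ->; apply: connect0.
  have nref : ~~ r e f by apply: contra nef; apply: arc.
  have [t [_ et tf]] := common2 irr W e e_f nref.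
  pose S := t |: R.
  have RS : R \subset S by apply: subsetUr.
  have tS : t \in S by apply: setU11.
  have inS x : x \in Z -> x \in S by move=> /ZR/(subsetP RS).
  have [|||g [dg gS Zg]] := dcyc_through (S := S) (L := Z) (semicomplete_sub ZsL).
  - exact: subset_trans ZsR RS.
  - move=> x y xZ yZ; apply: connect_trans (within_mono RS (toe x xZ)) _.
    apply: connect_trans (connect_arc (inS e eZ) tS et) _.
    exact: connect_trans (connect_arc tS (inS f fZ) tf) (within_mono RS (frf y yZ)).
  - by right; exists e, f.
  exists g; split=> //; left; exists t => x /gS; rewrite in_setU1.
  by case/orP=> [/eqP|]; auto.
have [big|nbig] := classic (2 < #|Z| \/ (exists x y, [/\ x \in Z, y \in Z, x != y & ~~ r x y])).
  have [g [dg gS Zg]] := dcyc_through (semicomplete_sub ZsL) ZsR all_con big.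
  by exists g; split=> //; left; exists z => x /gS; left.
have adj x y : x \in Z -> y \in Z -> x != y -> r x y.
  by move=> xL yL xy; apply: contraT => nxy; case: nbig; right; exists x, y.
have zR := ZR z zZ.
have fin2 g t t' : short r g -> {subset Z <= g} ->
    (forall x, x \in g -> [\/ x \in R, x = t | x = t']) ->
    (t \notin R -> t' \notin R -> count [in R] g <= 2) ->
  exists g, [/\ dcyc r g, {subset Z <= g} &
  (exists t, forall x, x \in g -> x \in R \/ x = t) \/
  (exists t t', (forall x, x \in g -> [\/ x \in R, x = t | x = t']) /\ count [in R] g <= 2)].
  move=> /andP[dg _] Zg gS cnt; exists g; split=> //.
  have [tR|tR] := boolP (t \in R).
    by left; exists t' => x /gS[|->|]; auto.
  have [t'R|t'R] := boolP (t' \in R).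
    by left; exists t => x /gS[||->]; auto.
  by right; exists t, t'; split=> //; apply: cnt.
have [[z' [z'Z z'z]]|only] := classic (exists z', z' \in Z /\ z' != z).
  have Z2 x : x \in Z -> x = z \/ x = z'.
    move=> xZ; have [|xz] := eqVneq x z; first by left.
    have [|xz'] := eqVneq x z'; first by right.
    by case: nbig; left; apply/card_gt2P; exists x, z, z'; split; split; rewrite // eq_sym.
  have zz' : r z z' by apply: adj; rewrite // eq_sym.
  have [p [pz pz' z'p]] : exists y, [/\ y != z, y != z' & r z' y].
    have [u [uz uz']] : exists u, u != z /\ u != z'.
      have : 0 < #|~: [set z; z']|.
        rewrite -(ltn_add2l #|[set z; z']|) cardsC addn0 cards2.
        by move: large Ts0; clear; case: (z != z'); lia.
      by case/card_gt0P => u; rewrite !inE negb_or => /andP[? ?]; exists u.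
    have [|nz'u] := boolP (r z' u); first by exists u.
    have z'u : z' != u by rewrite eq_sym.
    have [w [wz z'w _]] := common2 irr W z z'u nz'u.
    by exists w; split=> //; apply: contraTneq z'w => ->; rewrite irr.
  have [pz_|npz] := boolP (r p z).
    apply: (fin2 [:: z; z'; p] p p); first exact: short3.
    - by move=> x /Z2[]->; rewrite !inE eqxx ?orbT.
    - by move=> x; rewrite 3!inE => /or3P[]/eqP->; [constructor 1|constructor 1; apply: ZR|constructor 2].
    - by move=> /= /negPf-> _; case: (z \in R); case: (z' \in R).
  have [w [wz' pw wz]] := common2 irr W z' pz npz.
  apply: (fin2 [:: z; z'; p; w] p w).
  - by apply: short4 => //; rewrite eq_sym.
  - by move=> x /Z2[]->; rewrite !inE eqxx ?orbT.
  - by move=> x; rewrite 4!inE => /or4P[]/eqP->; [constructor 1|constructor 1; apply: ZR|constructor 2|constructor 3].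
  - by move=> /= /negPf-> /negPf->; case: (z \in R); case: (z' \in R).
have Z1 x : x \in Z -> x = z.
  by move=> xZ; apply/eqP; apply: contraT => xz; case: only; exists x.
have [/existsP[p /andP[zp npz]]|/existsPn sym1] := boolP [exists y, r z y && ~~ r y z].
  have pz : p != z by apply: contraTneq zp => ->; rewrite irr.
  have [w [_ pw wz]] := common2 irr W z pz npz.
  apply: (fin2 [:: z; p; w] p w); first exact: short3.
  - by move=> x /Z1->; rewrite mem_head.
  - by move=> x; rewrite 3!inE => /or3P[]/eqP->; [constructor 1|constructor 2|constructor 3].
  - by move=> /= /negPf-> /negPf->; case: (z \in R).
have [/existsP[p /andP[pz nzp]]|/existsPn sym2] := boolP [exists y, r y z && ~~ r z y].
  have zp : z != p by apply: contraTneq pz => ->; rewrite irr.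
  have [w [_ zw wp]] := common2 irr W z zp nzp.
  apply: (fin2 [:: z; w; p] p w); first exact: short3.
  - by move=> x /Z1->; rewrite mem_head.
  - by move=> x; rewrite 3!inE => /or3P[]/eqP->; [constructor 1|constructor 3|constructor 2].
  - by move=> /= /negPf-> /negPf->; case: (z \in R).
have [/existsP[v /and3P[vR vz nzv]]|/existsPn full] := boolP [exists v, [&& v \in R, v != z & ~~ r z v]].
  have nvz : ~~ r v z by have := sym2 v; rewrite negb_and negbK (negPf nzv) orbF.
  have zv : z != v by rewrite eq_sym.
  have [s [_ zs sv]] := common2 irr W z zv nzv.
  have [s' [s's vs' s'z]] := common2 irr W s vz nvz.
  apply: (fin2 [:: z; s; v; s'] s s').
  - by apply: short4; rewrite // eq_sym.
  - by move=> x /Z1->; rewrite mem_head.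
  - by move=> x; rewrite 4!inE => /or4P[]/eqP->; [constructor 1|constructor 2|constructor 1|constructor 3].
  - by move=> /= /negPf-> /negPf->; case: (z \in R); case: (v \in R).
(* Here [Z] is just [z], joined both ways to all other free vertices, so any arc of a free cycle
   avoiding [z] forms a triangle with it. *)
have [|c [dc cR cz]] := spare (Q := [set z]); first by rewrite cards1.
case: c dc cR cz => [|a [|b c]] dc cR cz; try by case/and3P: dc.
have ab : r a b by case/and3P: dc => /= /andP[].
have out x : x \in [:: a, b & c] -> r z x.
  by move=> xc; have := full x; rewrite cR //= -in_set1 cz //= negbK.
have aR := cR a (mem_head _ _).
have bc : b \in [:: a, b & c] by rewrite !inE eqxx orbT.
apply: (fin2 [:: z; a; b] z z).
- apply: short3 => //; first exact/out/mem_head.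
  by have := sym1 b; rewrite (out b bc) negbK.
- by move=> x /Z1->; rewrite mem_head.
- by move=> x; rewrite 3!inE => /or3P[]/eqP->; constructor 1; rewrite ?zR ?aR ?cR.
- by rewrite zR.
Qed.

Lemma cover_from_short : covered (size Ts).
Proof.
have [Z0|[z zZ]] := set_0Vmem Z.
  exists Ts; split=> //; first by apply/allP => T; apply: Ts_dcyc.
  move=> x xL; rewrite -[_ \in _]negbK -mem_R; apply: contraT; rewrite negbK => xR.
  by have : x \in Z by [rewrite inE xL]; rewrite Z0 inE.
have [g [dg Zg near]] := exists_cycle_near zZ.
have one t : (forall x, x \in g -> x \in R \/ x = t) -> covered (size Ts).
  move=> gt; have [tg|tg] := boolP ((t \in g) && (t \notin R)); last first.
    apply: (finish_free zZ dg Zg) => x xg; case: (gt x xg) => // xt.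
    by move: tg; rewrite -xt xg negbK.
  case/andP: tg => tg; rewrite mem_R negbK => /flattenP[T TT tT].
  apply: (@finish_hit z g [:: T] (rem T Ts)) => //.
  - exact: perm_to_rem.
  - by move=> T'; rewrite inE => /eqP->; apply/hasP; exists t.
  - by move=> x /gt[|->]; [left|right; rewrite /= cats0].
  - by left.
case: near => [[t gt]|[t [t' [gt cnt]]]]; first exact: one gt.
have [tg|tg] := boolP ((t \in g) && (t \notin R)); last first.
  apply: (one t') => x xg; case: (gt x xg) => [|xt|]; auto.
  by move: tg; rewrite -xt xg negbK; auto.
have [t'g|t'g] := boolP ((t' \in g) && (t' \notin R)); last first.
  apply: (one t) => x xg; case: (gt x xg) => [||xt]; auto.
  by move: t'g; rewrite -xt xg negbK; auto.
case/andP: tg => tg; rewrite mem_R negbK => /flattenP[T TT tT].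
case/andP: t'g => t'g; rewrite mem_R negbK => /flattenP[T' TT' tT'].
(* Both outside vertices may lie on the same cycle of [Ts], and then only one cycle is replaced. *)
have [e|TT'n] := eqVneq T' T.
  apply: (@finish_hit z g [:: T] (rem T Ts)) => //.
  - exact: perm_to_rem.
  - by move=> T2; rewrite inE => /eqP->; apply/hasP; exists t.
  - by rewrite /= cats0 => x /gt[|->|->]; [left|right|right; rewrite -e].
  - by left.
apply: (@finish_hit z g [:: T; T'] (rem T' (rem T Ts))) => //.
- rewrite (perm_trans (perm_to_rem TT)) //= perm_cons perm_to_rem //.
  by have := TT'; rewrite (perm_mem (perm_to_rem TT)) inE (negPf TT'n).
- by move=> T2; rewrite !inE => /orP[]/eqP->; apply/hasP; [exists t|exists t'].
- by move=> x /gt[|->|->]; auto; right; rewrite /= cats0 mem_cat ?tT ?tT' ?orbT.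
- by right.
Qed.
End CoverTheorem.

Lemma cover_semicomplete (V : finType) (r : rel V) (L : {set V}) k :
  irreflexive r -> ore r -> semicomplete r L -> 0 < k -> 12 * k + 3 <= #|V| ->
  exists s, [/\ size s = k, all (dcyc r) s, uniq (flatten s) & {subset L <= flatten s}].
Proof.
move=> irr W scL k0 large.
have [Ts [sz shT uT]] := short_family irr W k0 large.
rewrite -sz in k0 large *.
by apply: cover_from_short.
Qed.

(** * Families that cannot be extended *)

Lemma card_set_count (V : finType) (a : pred V) : #|[set w | a w]| = count a (enum V).
Proof.
rewrite cardE -size_filter; apply/perm_size/uniq_perm; [exact: enum_uniq | exact/filter_uniq/enum_uniq |] => w.
by rewrite mem_enum mem_filter mem_enum !inE andbT.
Qed.

Section Counts.
Variables (V : finType) (r : rel V).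
Implicit Types (C D G P : seq V) (u v x y : V).

Definition od v C := count (r v) C.
Definition ind v C := count (r^~ v) C.

Lemma od_cat v C D : od v (C ++ D) = od v C + od v D. Proof. exact: count_cat. Qed.
Lemma ind_cat v C D : ind v (C ++ D) = ind v C + ind v D. Proof. exact: count_cat. Qed.

Lemma perm_od v C D : perm_eq C D -> od v C = od v D. Proof. by move/permP; apply. Qed.
Lemma perm_ind v C D : perm_eq C D -> ind v C = ind v D. Proof. by move/permP; apply. Qed.

Lemma perm_map_next C : uniq C -> perm_eq (map (next C) C) C.
Proof.
move=> uC; have inj : injective (next C) := can_inj (prev_next uC).
apply: uniq_perm => //; first by rewrite map_inj_uniq.
move=> x; apply/mapP/idP => [[y yC ->]|xC]; first by rewrite mem_next.
by exists (prev C x); rewrite ?mem_prev ?next_prev.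
Qed.

Lemma count_gt_size (T : eqType) (a b : pred T) (s : seq T) : size s < count a s + count b s ->
  exists z : T, [/\ z \in s, a z & b z].
Proof.
rewrite -count_predUI => lt; have : has (predI a b) s.
  rewrite has_count; have := count_size (predU a b) s; move: lt; lia.
by case/hasP => x xs /andP[ax bx]; exists x.
Qed.

(** Pigeonhole over the pairs of consecutive vertices of the cycle: a path from [u] to [v] fits
    between [x] and its successor. *)
Lemma insertion_point C u v : uniq C -> size C < ind u C + od v C ->
  exists x, [/\ x \in C, r x u & r v (next C x)].
Proof.
move=> uC; rewrite /od -(permP (perm_map_next uC)) count_map => /count_gt_size.
by case=> x [xC xu vx]; exists x.
Qed.

(** The same for a path, which has one consecutive pair fewer; the arcs from its last vertex and to
    its first one are useless, whence the larger threshold. *)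
Lemma insertion_split u v C : (size C).+1 < ind u C + od v C ->
  exists D x y E, [/\ C = rcons D x ++ y :: E, r x u & r v y].
Proof.
have H x D : size D < ind u (belast x D) + od v D ->
    exists D1 x' y' E, [/\ x :: D = rcons D1 x' ++ y' :: E, r x' u & r v y'].
  elim: D x => [|y D IH] x; rewrite /ind /od //=.
  have [/andP[xu vy] _|no] := boolP (r x u && r v y); first by exists [::], x, y, D.
  move=> lt; have [|D1 [x' [y' [E [e xu vy]]]]] := IH y.
    by move: lt no; rewrite /ind /od; case: (r x u); case: (r v y) => //=; lia.
  by exists (x :: D1), x', y', E; rewrite /= -e.
case: C => [|x C] // lt; apply: H.
move: lt; rewrite {1}/ind lastI -cats1 count_cat -/(ind u _) /od /=.
rewrite [in count (r v) _]cats1 -lastI /= -/(od v C).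
by rewrite size_cat size_belast; case: (r (last x C) u); case: (r v x) => /=; lia.
Qed.

Lemma rot_next C x : uniq C -> x \in C -> 1 < size C -> exists t, exists2 i, rot i C = next C x :: rcons t x & perm_eq C (next C x :: rcons t x).
Proof.
move=> uC xC sz; have [i t e] := rot_to xC.
case: t e => [|y t] e; first by rewrite -(size_rot i) e in sz.
have nx : next C x = y by rewrite -(next_rot i uC) e /= eqxx.
have pe : perm_eq C (x :: y :: t) by rewrite -e perm_sym perm_rot.
exists t; rewrite nx; have [j ej] : exists j, rot j C = rot 1 (x :: y :: t).
  rewrite -e; have [hi|hi] := leqP i (size C); last by rewrite (rot_oversize (ltnW hi)); exists 1.
  by rewrite rot_add_mod ?size_rot //; [eexists | apply: ltnW].
exists j; first by rewrite ej rot1_cons.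
by rewrite (permPl pe) -rcons_cons perm_sym perm_rcons.
Qed.

End Counts.

(* A family [s] of cycles that admits no improvement, as given by a largest family
   covering all vertices of degree less than [#|V|] and all vertices adjacent to
   every other one; [hs] lists the uncovered vertices. *)
Record stuck (V : finType) (r : rel V) (s : seq (seq V)) (hs : seq V) : Prop := Stuck {
  stuck_dcyc : all (dcyc r) s;
  stuck_part : perm_eq (flatten s ++ hs) (enum V);
  stuck_max : forall s' ex, all (dcyc r) s' -> size s' = size s ->
    perm_eq (flatten s') (flatten s ++ ex) -> uniq ex -> {subset ex <= hs} -> ex = [::];
  stuck_deg : forall v, v \in hs -> #|V| <= od r v (enum V) + ind r v (enum V);
  stuck_nfull : forall v, v \in hs -> exists u, [/\ u != v, ~~ r v u & ~~ r u v];
  stuck_hs : 0 < size hs;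
  stuck_s : 0 < size s }.

Lemma perm_flatten_rev (T : eqType) (s : seq (seq T)) : perm_eq (flatten (map rev s)) (flatten s).
Proof.
elim: s => //= C s IH; apply: perm_cat => //.
by apply/permP => a; rewrite count_rev.
Qed.

Lemma stuck_conv (V : finType) (r : rel V) s hs : stuck r s hs -> stuck (conv r) (map rev s) hs.
Proof.
case=> dc part mx deg nf h0 s0; have pf := perm_flatten_rev s; split=> //.
- by rewrite all_map; apply: sub_all dc => C /=; rewrite dcyc_rev.
- by apply: perm_trans part; rewrite perm_cat2r.
- move=> s' ex dc' sz pe; apply: (mx (map rev s')).
  + by rewrite all_map; apply: sub_all dc' => C /=; rewrite -{1}(revK C) dcyc_rev.
  + by rewrite size_map sz size_map.
  + apply: perm_trans (perm_flatten_rev s') (perm_trans pe _).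
    by rewrite perm_cat2r.
- by move=> v vh; rewrite addnC; apply: deg.
- by move=> v vh; have [u [? ? ?]] := nf v vh; exists u.
- by rewrite size_map.
Qed.

(** * Structure of a family that cannot be improved *)

Section Stuck.
Variables (V : finType) (r : rel V).
Implicit Types (C D G P : seq V) (u v w x y : V).
Hypothesis irr : irreflexive r.
Hypothesis W : ore r.
Variables (s : seq (seq V)) (hs : seq V).
Hypothesis st : stuck r s hs.
Notation F := (flatten s).
Notation h := (size hs).

Lemma hs_nonempty : exists v, v \in hs.
Proof. by case: (hs) (stuck_hs st) => // v l _; exists v; apply: mem_head. Qed.

Lemma part_uniq : uniq (F ++ hs).
Proof. by rewrite (perm_uniq (stuck_part st)) enum_uniq. Qed.

Lemma hs_uniq : uniq hs.
Proof. by have := part_uniq; rewrite cat_uniq => /and3P[]. Qed.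

Lemma mem_part x : (x \in F) || (x \in hs).
Proof. by rewrite -mem_cat (perm_mem (stuck_part st)) mem_enum. Qed.

Lemma F_not_hs x : x \in F -> x \in hs -> False.
Proof.
move=> xF xh; have := part_uniq; by rewrite cat_uniq => /and3P[_ /hasPn/(_ x xh)/negP].
Qed.

Lemma card_part : #|V| = size F + h.
Proof. by rewrite -size_cat (perm_size (stuck_part st)) cardE. Qed.

Lemma odE v : od r v (enum V) = od r v F + od r v hs.
Proof. by rewrite -od_cat; apply/perm_od; rewrite perm_sym (stuck_part st). Qed.

Lemma indE v : ind r v (enum V) = ind r v F + ind r v hs.
Proof. by rewrite -ind_cat; apply/perm_ind; rewrite perm_sym (stuck_part st). Qed.

Lemma ore_part u v : u != v -> ~~ r u v ->
  size F + h <= od r u F + od r u hs + (ind r v F + ind r v hs).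
Proof.
move=> uv nuv; have := W uv nuv.
by rewrite !card_set_count -/(od r u _) -/(ind r v _) odE indE card_part.
Qed.

Lemma mem_cycle C x : C \in s -> x \in C -> x \in F.
Proof. by move=> Cs xC; apply/flattenP; exists C. Qed.

Lemma cycle_dcyc C : C \in s -> dcyc r C.
Proof. by move/(allP (stuck_dcyc st)). Qed.

Lemma cycle_size C : C \in s -> 2 < size C.
Proof. by case/cycle_dcyc/and3P. Qed.

Lemma cycle_uniq C : C \in s -> uniq C.
Proof. by case/cycle_dcyc/and3P. Qed.

Lemma perm1 C : C \in s -> perm_eq F (C ++ flatten (rem C s)).
Proof. by move=> Cs; apply: perm_trans (perm_flatten (perm_to_rem Cs)) _. Qed.

Lemma perm2s C D : C \in s -> D \in s -> D != C -> perm_eq s (C :: D :: rem D (rem C s)).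
Proof.
move=> Cs Ds DC; apply: perm_trans (perm_to_rem Cs) _; rewrite perm_cons.
apply: perm_to_rem; have := Ds; rewrite (perm_mem (perm_to_rem Cs)) inE.
by rewrite (negPf DC).
Qed.

Lemma perm2 C D : C \in s -> D \in s -> D != C ->
  perm_eq F (C ++ D ++ flatten (rem D (rem C s))).
Proof.
by move=> Cs Ds DC; apply: perm_trans (perm_flatten (perm2s Cs Ds DC)) _.
Qed.

Lemma uniq_extra A B ex : perm_eq F (A ++ B) -> uniq ex -> {subset ex <= hs} -> uniq (A ++ ex).
Proof.
move=> pF uex sub; have := part_uniq.
rewrite (cat_uniq F) => /and3P[]; rewrite (perm_uniq pF) cat_uniq => /andP[uA _] /hasPn dis _.
rewrite cat_uniq uA uex andbT; apply/hasPn => x /sub /dis; apply: contra => /= xA.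
by rewrite (perm_mem pF) mem_cat xA.
Qed.

Lemma improve1 C C' ex : C \in s -> cycle r C' -> 2 < size C' ->
  perm_eq C' (C ++ ex) -> uniq ex -> {subset ex <= hs} -> ex = [::].
Proof.
move=> Cs cC' sC' pe uex sub.
have uC' : uniq C' by rewrite (perm_uniq pe); apply: uniq_extra (perm1 Cs) uex sub.
apply: (stuck_max st (s' := C' :: rem C s)) => //.
- rewrite /= /dcyc cC' uC' sC'; apply/allP => D /mem_rem; exact: cycle_dcyc.
- by rewrite /= (perm_size (perm_to_rem Cs)).
- apply/permP => a; have := permP (perm1 Cs) a; have := permP pe a.
  by rewrite /= !count_cat => -> ->; clear; lia.
Qed.

Lemma improve2 C1 C2 D1 D2 ex : C1 \in s -> C2 \in s -> C2 != C1 -> cycle r D1 -> cycle r D2 ->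
  2 < size D1 -> 2 < size D2 -> perm_eq (D1 ++ D2) (C1 ++ C2 ++ ex) -> uniq ex ->
  {subset ex <= hs} -> ex = [::].
Proof.
move=> C1s C2s C21 c1 c2 s1 s2 pe uex sub.
have p2 := perm2 C1s C2s C21.
have : uniq (D1 ++ D2).
  by rewrite (perm_uniq pe) catA; apply: (uniq_extra (B := flatten (rem C2 (rem C1 s)))); rewrite -?catA.
rewrite cat_uniq => /and3P[u1 _ u2].
apply: (stuck_max st (s' := [:: D1, D2 & rem C2 (rem C1 s)])) => //.
- rewrite /= /dcyc c1 c2 u1 u2 s1 s2 /=; apply/allP => D /mem_rem/mem_rem; exact: cycle_dcyc.
- by rewrite (perm_size (perm2s C1s C2s C21)).
- apply/permP => a; have := permP p2 a; have := permP pe a.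
  by rewrite /= !count_cat; clear; lia.
Qed.

Definition hpath P u v := [/\ exists2 p, P = u :: p & path r u p /\ last u p = v, uniq P & {subset P <= hs}].

Lemma insert_perm C x P u v : C \in s -> x \in C -> r x u -> r v (next C x) ->
  (exists2 p, P = u :: p & path r u p /\ last u p = v) ->
  exists C', [/\ cycle r C', 2 < size C' & perm_eq C' (C ++ P)].
Proof.
move=> Cs xC xu vn [p -> [pth lst]].
have sz := cycle_size Cs.
have [t [i e] pe] := rot_next (cycle_uniq Cs) xC (ltnW sz).
have cyc : cycle r (next C x :: rcons t x) by rewrite -e rot_cycle; apply: dcyc_cycle (cycle_dcyc Cs).
exists (next C x :: rcons t x ++ u :: p); split.
- move: cyc; rewrite /= rcons_cat rcons_path last_rcons cat_path => /andP[-> _].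
  by rewrite last_rcons /= xu rcons_path pth lst vn.
- by rewrite -cat_cons size_cat -(perm_size pe); apply: leq_trans sz (leq_addr _ _).
- by rewrite -cat_cons perm_cat2r perm_sym.
Qed.

Lemma no_insert C P u v : C \in s -> hpath P u v -> ind r u C + od r v C <= size C.
Proof.
move=> Cs [ex uP sub]; rewrite leqNgt; apply/negP.
case/(insertion_point (cycle_uniq Cs)) => x [xC xu vn].
have [C' [cC' sC' pe]] := insert_perm Cs xC xu vn ex.
have := improve1 Cs cC' sC' pe uP sub.
by case: ex => p -> _.
Qed.

Lemma sum_bound (f : seq V -> nat) (l : seq (seq V)) :
  (forall C D, f (C ++ D) = f C + f D) -> f [::] = 0 ->
  (forall C, C \in l -> f C <= size C) -> f (flatten l) <= size (flatten l).
Proof.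
move=> fc f0; elim: l => [|C l IH] fl /=; first by rewrite f0.
rewrite fc size_cat; apply: leq_add; first exact: fl (mem_head _ _).
by apply: IH => D Dl; apply: fl; rewrite inE Dl orbT.
Qed.

Lemma iod_cat u v C D :
  ind r u (C ++ D) + od r v (C ++ D) = ind r u C + od r v C + (ind r u D + od r v D).
Proof. by rewrite ind_cat od_cat addnACA. Qed.

Lemma iod_bound u v (l : seq (seq V)) :
  (forall C, C \in l -> ind r u C + od r v C <= size C) ->
  ind r u (flatten l) + od r v (flatten l) <= size (flatten l).
Proof.
by apply: (@sum_bound (fun C => ind r u C + od r v C)) => // C D; apply: iod_cat.
Qed.

Lemma no_insert_all P u v : hpath P u v -> ind r u F + od r v F <= size F.
Proof. by move=> hp; apply: iod_bound => C Cs; apply: no_insert hp. Qed.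

Lemma hpath1 u : u \in hs -> hpath [:: u] u u.
Proof. by move=> uh; split=> //; [exists [::] | move=> x; rewrite inE => /eqP->]. Qed.

(** A single uncovered vertex cannot be inserted into any cycle, so at most [size F] of its degree
    goes to covered vertices. *)
Lemma deg_hs v : v \in hs -> h <= od r v hs + ind r v hs.
Proof.
move=> vh; have := stuck_deg st vh; have := no_insert_all (hpath1 vh).
by rewrite odE indE card_part; lia.
Qed.

Let H := [set x in hs].
Notation con := (connect (within r H)).

Lemma con_hpath u v : u \in hs -> con u v -> exists P, hpath P u v.
Proof.
move=> uh c; have [|p [pth lst up sub]] := connect_within c; first by rewrite inE.
exists (u :: p); split=> //; first by exists p.
by move=> x /sub; rewrite inE.
Qed.

Lemma con_arc u v : u \in hs -> v \in hs -> r u v -> con u v.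
Proof. by move=> uh vh; apply: connect_arc; rewrite inE. Qed.

Lemma size_lt_count (a : pred V) v : v \in hs -> ~~ a v -> count a hs < h.
Proof.
move=> vh nav; rewrite -(count_predC a) -[ltnLHS]addn0 ltn_add2l -has_count.
by apply/hasP; exists v.
Qed.

(** A path from [u] to [v] cannot be inserted, so the Ore inequality for the absent arc from [v] to
    [u] gives [h] arcs inside [hs]. Without a path from [v] to [u] the neighbourhoods counted are
    disjoint and miss [v], so they have fewer than [h] elements. *)
Lemma con_sym_aux u v : u \in hs -> v \in hs -> con u v -> con v u.
Proof.
move=> uh vh uv; apply: contraT => nvu; have [P hP] := con_hpath uh uv.
have vu : v != u by apply: contraNneq nvu => ->; apply: connect0.
have nr : ~~ r v u by apply: contra nvu; apply: con_arc.
have le : h <= od r v hs + ind r u hs.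
  by have := ore_part vu nr; have := no_insert_all hP; lia.
have [/hasP[w wh /andP[vw wu]]|no] := boolP (has (predI (r v) (r^~ u)) hs).
  by case/negP: nvu; apply: connect_trans (con_arc vh wh vw) (con_arc wh uh wu).
move: le; rewrite /od /ind -count_predUI leqNgt => /negP[].
rewrite has_count -eqn0Ngt in no; rewrite (eqP no) addn0.
by apply: (size_lt_count vh); rewrite /= irr.
Qed.

(** By [deg_hs] each component has more than half of the uncovered vertices, so there is only
    one. *)
Lemma con_all u v : u \in hs -> v \in hs -> con u v.
Proof.
move=> uh vh; apply: contraT => nuv.
have half x : x \in hs -> h.+2 <= (count (con x) hs).*2.
  move=> xh; apply: leq_trans (_ : (od r x hs + ind r x hs).+2 <= _).
    by rewrite !ltnS deg_hs.
  have lt (a : pred V) : ~~ a x -> (forall y, y \in hs -> a y -> con x y) -> count a hs < count (con x) hs.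
    move=> nax sub; rewrite -!size_filter -[ltnRHS](@perm_size _ (x :: rem x (filter (con x) hs))); last first.
      by rewrite perm_sym; apply: perm_to_rem; rewrite mem_filter connect0.
    rewrite /= ltnS; apply: uniq_leq_size; first by rewrite filter_uniq ?hs_uniq.
    move=> y; rewrite mem_filter => /andP[ay yh].
    rewrite mem_rem_uniq ?filter_uniq ?hs_uniq // inE mem_filter yh sub //.
    by apply/andP; split=> //; apply/eqP => e; rewrite -e ay in nax.
  have l1 := lt (r x) _ _; have l2 := lt (r^~ x) _ _.
  rewrite /od /ind -addnn -addnS -addSn; apply: leq_add; [apply: l1 | apply: l2]; rewrite ?irr // => y yh xy.
    exact: con_arc.
  by apply: con_sym_aux => //; apply: con_arc.
have [hu hv] := (half u uh, half v vh).
have : count (con u) hs + count (con v) hs <= h.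
  rewrite -count_predUI; have -> : count (predI (con u) (con v)) hs = 0.
    apply/eqP; rewrite eqn0Ngt -has_count; apply/hasP => -[w wh /andP[uw vw]].
    case/negP: nuv; apply: connect_trans uw _; exact: con_sym_aux.
  by rewrite addn0 count_size.
lia.
Qed.

Lemma exists_hpath u v : u \in hs -> v \in hs -> exists P, hpath P u v.
Proof. by move=> uh vh; apply: con_hpath (con_all uh vh). Qed.

Lemma no_insert_cycle C u v : C \in s -> u \in hs -> v \in hs ->
  ind r u C + od r v C <= size C.
Proof. by move=> Cs uh vh; have [P hP] := exists_hpath uh vh; apply: no_insert hP. Qed.

(** The uncovered vertices inherit the Ore condition with their own number [h]. *)
Lemma ore_hs u v : u \in hs -> v \in hs -> v != u -> ~~ r v u ->
  h <= od r v hs + ind r u hs.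
Proof.
move=> uh vh vu nr; have [P hP] := exists_hpath uh vh.
by have := ore_part vu nr; have := no_insert_all hP; lia.
Qed.


Lemma cycle_insert (A : seq V) x y B u p : cycle r (rcons A x ++ y :: B) -> r x u ->
  path r u p -> r (last u p) y -> cycle r (rcons A x ++ (u :: p) ++ y :: B).
Proof.
move=> cyc xu pth vy; rewrite catA cycle_catC /= rcons_cat cat_path rcons_path cat_path.
move: cyc; rewrite cycle_catC /= rcons_cat cat_path (rcons_path _ _ (rcons A x)) => /and3P[-> -> _].
by rewrite last_cat last_rcons /= xu pth vy.
Qed.

Lemma cycle_close c' (t : seq V) u p : path r c' t -> r (last c' t) u -> path r u p ->
  r (last u p) c' -> cycle r ((c' :: t) ++ (u :: p)).
Proof.
by move=> pt cu pp vc; rewrite /= rcons_cat cat_path pt /= cu rcons_path pp.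
Qed.

Lemma rem_neq C D : C \in s -> D \in rem C s -> D \in s /\ D != C.
Proof.
move=> Cs Dr; have Ds := mem_rem Dr; split=> //; apply/eqP => e.
have := part_uniq; rewrite cat_uniq (perm_uniq (perm1 Cs)) cat_uniq => /andP[/and3P[_ /hasPn dis _] _].
case: D => [|x D] in Dr Ds e *; first by have := cycle_size Ds.
have xC : x \in C by rewrite -e mem_head.
have xf : x \in flatten (rem C s) by apply/flattenP; exists (x :: D); rewrite ?mem_head.
by have := dis x xf; rewrite /= xC.
Qed.

Lemma od_lt v C : v \in C -> od r v C < size C.
Proof.
move=> vC; rewrite /od -(count_predC (r v) C) -[ltnLHS]addn0 ltn_add2l -has_count.
by apply/hasP; exists v; rewrite //= irr.
Qed.

Lemma ind_lt v C : v \in C -> ind r v C < size C.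
Proof.
move=> vC; rewrite /ind -(count_predC (r^~ v) C) -[ltnLHS]addn0 ltn_add2l -has_count.
by apply/hasP; exists v; rewrite //= irr.
Qed.

Lemma count0 (a : pred V) C : (forall x, x \in C -> ~~ a x) -> count a C = 0.
Proof. by move=> na; apply/eqP; rewrite eqn0Ngt -has_count; apply/hasPn. Qed.

Lemma split_part C : C \in s -> forall u v, ind r u F + od r v F =
  ind r u C + od r v C + (ind r u (flatten (rem C s)) + od r v (flatten (rem C s))).
Proof. by move=> Cs u v; rewrite (perm_ind _ _ (perm1 Cs)) (perm_od _ _ (perm1 Cs)) iod_cat. Qed.

Lemma size_part C : C \in s -> size F = size C + size (flatten (rem C s)).
Proof. by move=> Cs; rewrite (perm_size (perm1 Cs)) size_cat. Qed.

Lemma rest_bound C u : C \in s -> u \in hs ->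
  ind r u (flatten (rem C s)) + od r u (flatten (rem C s)) <= size (flatten (rem C s)).
Proof.
by move=> Cs uh; apply: iod_bound => D /mem_rem Ds; apply: no_insert_cycle.
Qed.

Lemma in_rest C u v : size (flatten (rem C s)) <
    ind r u (flatten (rem C s)) + od r v (flatten (rem C s)) ->
  exists2 D, D \in rem C s & size D < ind r u D + od r v D.
Proof.
move=> lt; apply: NNPP => nex; move: lt; rewrite ltnNge => /negP[].
apply: iod_bound => D Ds; rewrite leqNgt; apply/negP => h; apply: nex; by exists D.
Qed.

Lemma F_neq_hs x w : x \in F -> w \in hs -> x != w.
Proof. by move=> xF wh; apply/eqP => e; apply: (F_not_hs xF); rewrite e. Qed.

(* [C] is cut into an arc [c' :: sg] whose ends are joined through [hs], and the
   gap [G]: the gap is either shortened or inserted elsewhere in the family. *)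
Lemma gap C c' sg G u v : C \in s -> perm_eq C ((c' :: sg) ++ G) -> cycle r ((c' :: sg) ++ G) ->
  r (last c' sg) u -> r v c' -> u \in hs -> v \in hs -> 0 < size sg \/ u != v -> False.
Proof.
move=> Cs; have [m] := ubnP (size G); elim: m => // m IH in c' sg G u v *.
rewrite ltnS => leG pe cyc cu vc uh vh big.
(* The last hypothesis ensures that closing the arc through [hs] does not produce a digon. *)
have [P hP szP] : exists2 P, hpath P u v & 2 < size (c' :: sg) + size P.
  have [euv|nuv] := eqVneq u v.
    exists [:: u]; first by rewrite -euv; apply: hpath1.
    by case: big => [|/eqP //]; rewrite /= addn1 !ltnS.
  have [P hP] := exists_hpath uh vh; exists P => //.
  case: hP => -[[|x p] -> [_ lst]] _ _; first by rewrite -lst eqxx in nuv.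
  by rewrite /= !addSn !addnS.
case: (hP) => -[p eP [pth lst]] uP Ph.
have Pn0 : P <> [::] by rewrite eP.
have psg : path r c' sg by move: cyc; rewrite /= rcons_cat cat_path => /andP[].
have cP : cycle r ((c' :: sg) ++ P) by rewrite eP; apply: cycle_close; rewrite ?lst.
case: G => [|g1 G'] in leG pe cyc *.
  apply: Pn0; apply: (improve1 Cs cP) => //; first by rewrite size_cat.
  by rewrite perm_cat2r perm_sym -(cats0 (c' :: sg)).
set G := g1 :: G' in leG pe cyc *; set gm := last g1 G'.
have GF x : x \in G -> x \in F.
  by move=> xG; apply: (mem_cycle Cs); rewrite (perm_mem pe) mem_cat xG orbT.
(* An arc between the gap and [hs] would prolong the arc of [C] and leave a shorter gap. *)
have no_out g w : g \in G -> w \in hs -> ~~ r g w.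
  move=> gG wh; apply/negP => gw; case/splitPr: gG leG pe cyc => A B leG pe cyc.
  apply: (IH c' (sg ++ rcons A g) B w v) => //.
  - by move: leG; rewrite size_cat /= addnS; apply: leq_trans; rewrite ltnS leq_addl.
  - by rewrite -cat_cons -catA cat_rcons.
  - by rewrite -cat_cons -catA cat_rcons.
  - by rewrite last_cat last_rcons.
  - by left; rewrite size_cat size_rcons addnS.
have no_in g w : g \in G -> w \in hs -> ~~ r w g.
  move=> gG wh; apply/negP => wg; case/splitPr: gG leG pe cyc => A B leG pe cyc.
  apply: (IH g (B ++ c' :: sg) A u w) => //.
  - by move: leG; rewrite size_cat /= addnS; apply: leq_trans; rewrite ltnS leq_addr.
  - apply/permP => a; rewrite (permP pe a) !(count_cat, cat_cons) /= !(count_cat, cat_cons).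
    by rewrite /=; clear; lia.
  - by move: cyc; rewrite catA cycle_catC catA.
  - by rewrite last_cat.
  - by left; rewrite size_cat /= addnS.
have g1G : g1 \in G := mem_head _ _.
have gmG : gm \in G := mem_last _ _.
have O1 := ore_part (F_neq_hs (GF gm gmG) uh) (no_out gm u gmG uh).
have O2 := ore_part (u := u) (v := g1); rewrite eq_sym in O2.
have {}O2 := O2 (F_neq_hs (GF g1 g1G) uh) (no_in g1 u g1G uh).
have z1 : od r gm hs = 0 by apply: count0 => x; apply: no_out.
have z2 : ind r g1 hs = 0 by apply: count0 => x xh; apply: no_in.
have z3 : ind r u G = 0 by apply: count0 => x xG; apply: no_out.
have z4 : od r u G = 0 by apply: count0 => x xG; apply: no_in.
have l1 := od_lt gmG; have l2 := ind_lt g1G.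
have l3 := od_lt uh; have l4 := ind_lt uh.
have segb : ind r u (c' :: sg) + od r u (c' :: sg) <= (size (c' :: sg)).+1.
  rewrite leqNgt; apply/negP => /insertion_split[D [x [y [E [e xu uy]]]]].
  move: (cyc); rewrite e -catA cat_cons => /(cycle_insert (u := u) (p := [::]))/(_ xu isT uy) cI.
  suff : [:: u] = [::] by [].
  apply: (improve1 Cs cI) => //.
  - by rewrite !size_cat size_rcons /= !addnS.
  - apply/permP => a; have := permP pe a; rewrite e !count_cat /= => ->.
    by rewrite !count_cat /=; clear; lia.
  - by move=> z; rewrite inE => /eqP->.
have sC : size C = size (c' :: sg) + size G by rewrite (perm_size pe) size_cat.
have S1 := split_part Cs u u; have S2 := split_part Cs g1 gm.
rewrite (perm_ind _ _ pe) (perm_od _ _ pe) iod_cat in S1.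
rewrite (perm_ind _ _ pe) (perm_od _ _ pe) iod_cat in S2.
have R1 := rest_bound Cs uh; have sF := size_part Cs.
(* The Ore inequalities for [gm], [u] and for [u], [g1] are added. The surplus of 3 suffices to
   insert the gap into another cycle or, with the threshold of [insertion_split], into the arc
   itself. *)
have tot : size (c' :: sg) + size (flatten (rem C s)) + 3 <=
    ind r g1 (c' :: sg) + od r gm (c' :: sg) +
    (ind r g1 (flatten (rem C s)) + od r gm (flatten (rem C s))).
  move: O1 O2 z1 z2 z3 z4 l1 l2 l3 l4 segb sC S1 S2 R1 sF; clear.
  by lia.
have pG : exists2 q, G = g1 :: q & path r g1 q /\ last g1 q = gm.
  exists G' => //; split=> //; move: cyc; rewrite /G /= rcons_cat cat_path /= => /and3P[_ _].
  by rewrite rcons_path => /andP[].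
have [lt|le] := ltnP (size (flatten (rem C s)))
    (ind r g1 (flatten (rem C s)) + od r gm (flatten (rem C s))).
  have [D Dr /insertion_point] := in_rest lt.
  have [Ds DC] := rem_neq Cs Dr; case/(_ (cycle_uniq Ds)) => x [xD xg1 gmn].
  have [D' [cD' sD' peD]] := insert_perm Ds xD xg1 gmn pG.
  apply: Pn0; apply: (improve2 Cs Ds DC cP cD') => //; first by rewrite size_cat.
  apply/permP => a; have := permP pe a; have := permP peD a.
  by rewrite !count_cat => -> ->; clear; lia.
have [|D [x [y [E [e xg1 gmy]]]]] := @insertion_split _ r g1 gm (c' :: sg).
  by move: tot le; clear; lia.
have [q eq [pthq lstq]] := pG.
move: cP; rewrite e -catA cat_cons => cP.
have cI := cycle_insert cP xg1 pthq; rewrite lstq in cI; have {}cI := cI gmy.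
apply: Pn0; apply: (improve1 Cs cI) => //.
  by rewrite !size_cat size_rcons /= eP /= !addnS.
apply/permP => a; have := permP pe a; rewrite e -eq !count_cat /= => ->.
by rewrite !count_cat /=; clear; lia.
Qed.

Lemma size_hs_gt1 : 1 < h.
Proof.
have [v vh] := hs_nonempty.
by have := deg_hs vh; have := od_lt vh; have := ind_lt vh; clear; lia.
Qed.

Lemma count_hs (a : pred V) : count a hs = #|[set w in hs | a w]|.
Proof.
rewrite -size_filter -(card_uniqP (filter_uniq a hs_uniq)).
by apply: eq_card => w; rewrite inE mem_filter andbC.
Qed.

(** Otherwise a low-degree pair outside [Q] has degree sum at most [2 (1 + #|Q|)] inside [hs],
    against [ore_hs]. *)
Lemma hs_cycle (Q : {set V}) : 2 < #|H :\: Q| -> 2 + (#|Q|).*2 < h ->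
  exists D, [/\ dcyc r D, {subset D <= hs} & forall x, x \in D -> x \notin Q].
Proof.
move=> big lt; apply: NNPP => nex.
have ac : acyc r (H :\: Q).
  move=> D dD sub; apply: nex; exists D; split=> // x /sub; rewrite !inE => /andP[] //.
have [x [y [xH yH xy nxy [dx dy]]]] := acyc_low_degree_pair irr ac big.
have [xh yh] : x \in hs /\ y \in hs by move: xH yH; rewrite !inE => /andP[_ ->] /andP[_ ->].
have bound (a : pred V) : count a hs <= #|[set w in H :\: Q | a w]| + #|Q|.
  rewrite count_hs; apply: leq_trans (leq_card_setU _ _).1.
  apply/subset_leq_card/subsetP => w; rewrite !inE => /andP[-> ->].
  by rewrite !andbT orbC orbN.
have := ore_hs yh xh xy nxy; move: (bound (r x)) (bound (r^~ y)) dx dy lt.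
by rewrite /od /ind; clear; lia.
Qed.

Lemma hs_cycle1 u : u \in hs -> 4 < h ->
  exists D, [/\ dcyc r D, {subset D <= hs} & u \notin D].
Proof.
move=> uh lt; have [||D [dD Dh DQ]] := @hs_cycle [set u].
- have -> : #|H :\: [set u]| = h.-1.
    have <- : #|H| = h by rewrite cardsE; apply/card_uniqP/hs_uniq.
    by rewrite [#|H|](cardsD1 u) inE uh.
  by move: lt; clear; lia.
- by rewrite cards1.
by exists D; split=> //; apply/negP => /DQ; rewrite inE eqxx.
Qed.

(** In every other case the arc of [C] from [c'] to [c] can be closed through [hs], which [gap]
    excludes. *)
Lemma contact_same C c c' u v : C \in s -> c \in C -> c' \in C -> u \in hs -> v \in hs ->
  r c u -> r v c' -> c = c' /\ u = v.
Proof.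
move=> Cs cC c'C uh vh cu vc; apply: NNPP => ne.
have [i t e] := rot_to c'C.
have cin : c \in c' :: t by rewrite -e mem_rot.
have pe : perm_eq C (c' :: t) by rewrite -e perm_sym perm_rot.
have cyc : cycle r (c' :: t) by rewrite -e rot_cycle; apply/dcyc_cycle/cycle_dcyc.
case/splitPl: cin e pe cyc => p1 p2 lst e pe cyc.
apply: (@gap C c' p1 p2 u v) => //; first by rewrite lst.
case: p1 lst {e pe cyc} => [|? ?] lst; [right|by left].
by apply/eqP => uv; apply: ne.
Qed.

(* Otherwise, by [gap], a single pair [c, u] carries all arcs between [C] and [hs];
   then [C] and [u] are inserted into another cycle, and [hs] without [u] still
   contains a cycle that takes the place of [C]. *)
Lemma pure C : C \in s -> (forall c w, c \in C -> w \in hs -> ~~ r c w) \/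
  (forall c w, c \in C -> w \in hs -> ~~ r w c).
Proof.
move=> Cs; apply: NNPP => np.
have [[c [u [cC uh cu]]] [c' [v [c'C vh vc]]]] : (exists c u, [/\ c \in C, u \in hs & r c u]) /\
    (exists c u, [/\ c \in C, u \in hs & r u c]).
  split; apply: NNPP => nex; apply: np; [left|right] => c w cC wh; apply/negP => cw; apply: nex; by exists c, w.
have [e1 e2] := contact_same Cs cC c'C uh vh cu vc.
move: vc; rewrite -e1 -e2 => uc {c' v c'C vh e1 e2}.
have out_c x w : x \in C -> w \in hs -> r x w -> x = c /\ w = u.
  by move=> xC wh xw; have [-> ->] := contact_same Cs xC cC wh uh xw uc.
have in_c x w : x \in C -> w \in hs -> r w x -> x = c /\ w = u.
  by move=> xC wh xw; have [-> ->] := contact_same Cs cC xC uh wh cu xw.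
have [w [wh wu]] : exists w, w \in hs /\ w != u.
  have : 0 < #|H :\ u|.
    have := cardsD1 u H; rewrite inE uh cardsE (card_uniqP hs_uniq).
    by have := size_hs_gt1; clear; lia.
  by case/card_gt0P => w; rewrite !inE => /andP[? ?]; exists w.
have sC := cycle_size Cs; have sF := size_part Cs.
(* The vertex [w] has no arcs to or from [C], so its degree inside [hs] is at least [size C + h],
   while it is at most [2 (h - 1)]. *)
have h5 : 4 < h.
  have z1 : ind r w C = 0.
    by apply: count0 => x xC; apply/negP => /(out_c x w xC wh)[_ e]; rewrite e eqxx in wu.
  have z2 : od r w C = 0.
    by apply: count0 => x xC; apply/negP => /(in_c x w xC wh)[_ e]; rewrite e eqxx in wu.
  have := stuck_deg st wh; rewrite odE indE card_part; have := split_part Cs w w.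
  have := rest_bound Cs wh; have := od_lt wh; have := ind_lt wh.
  by move: sC sF z1 z2; clear; lia.
have [D [dD Dh uD]] := hs_cycle1 uh h5.
have [t [i e] pe] := rot_next (cycle_uniq Cs) cC (ltnW sC).
set g1 := next C c in e pe.
have uC : uniq (g1 :: rcons t c) by rewrite -(perm_uniq pe) cycle_uniq.
have cyc : cycle r (g1 :: rcons t c) by rewrite -e rot_cycle; apply/dcyc_cycle/cycle_dcyc.
have g1C : g1 \in C by rewrite (perm_mem pe) mem_head.
have g1c : g1 != c.
  by move: uC; rewrite /= mem_rcons inE negb_or => /andP[/andP[]].
have nug : ~~ r u g1.
  by apply/negP => /(in_c g1 u g1C uh)[e1 _]; rewrite e1 eqxx in g1c.
have ug : u != g1 by rewrite eq_sym; apply: F_neq_hs uh; apply: mem_cycle Cs g1C.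
(* At most [size C] of the arcs counted here are on [C] and at most [h - 1] in [hs], so some other
   cycle admits the path that runs along [C] from [g1] to [c] and ends in [u]. *)
have O := ore_part ug nug.
have z1 : ind r g1 hs = 0.
  by apply: count0 => x xh; apply/negP => /(in_c g1 x g1C xh)[e1 _]; rewrite e1 eqxx in g1c.
have z2 : od r u C <= 1.
  rewrite (perm_od _ _ pe) -rcons_cons -cats1 od_cat [X in X + _](_ : _ = 0).
    by rewrite /od /=; case: (r u c).
  apply: count0 => x xt; have xC : x \in C by rewrite (perm_mem pe) -rcons_cons mem_rcons inE xt orbT.
  apply/negP => /(in_c x u xC uh)[e1 _]; move: uC; rewrite -rcons_cons rcons_uniq -e1 xt.
  by [].
have l1 := ind_lt g1C; have l2 := od_lt uh; have S := split_part Cs g1 u.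
have lt : size (flatten (rem C s)) <
    ind r g1 (flatten (rem C s)) + od r u (flatten (rem C s)).
  by move: O z1 z2 l1 l2 S sF; clear; lia.
have [C2 C2r /insertion_point] := in_rest lt.
have [C2s C2C] := rem_neq Cs C2r; case/(_ (cycle_uniq C2s)) => x [xC xg1 un].
have pth : exists2 p, g1 :: rcons (rcons t c) u = g1 :: p & path r g1 p /\ last g1 p = u.
  exists (rcons (rcons t c) u) => //; rewrite last_rcons rcons_path last_rcons cu andbT.
  by move: cyc; rewrite /= rcons_path => /andP[].
have [C2' [c2' s2' pe2]] := insert_perm C2s xC xg1 un pth.
suff : u :: D = [::] by [].
apply: (improve2 Cs C2s C2C (dcyc_cycle dD) c2') => //.
- by case/and3P: dD.
- apply/permP => a; have := permP pe2 a; have := permP pe a.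
  rewrite !count_cat /= -!cats1 !count_cat /= => -> ->.
  by clear; lia.
- by rewrite /= uD; apply: dcyc_uniq dD.
- by move=> z; rewrite inE => /orP[/eqP->|/Dh].
Qed.

(* Each covered vertex is joined to [u] in at most one direction. *)
Lemma few_missed u : u \in hs ->
  count (fun x => ~~ r u x && ~~ r x u) F + h <= od r u hs + ind r u hs.
Proof.
move=> uh; have := stuck_deg st uh; rewrite odE indE card_part.
suff : od r u F + ind r u F + count (fun x => ~~ r u x && ~~ r x u) F <= size F by clear; lia.
rewrite /od /ind -count_predUI [count (predI _ _) _]count0 ?addn0.
  rewrite -(count_predC (predU (r u) (r^~ u)) F) leq_add2l.
  by apply: sub_count => x /=; rewrite negb_or.
move=> x /flattenP[C Cs xC]; apply/negP => /= /andP[ux xu].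
by have [h1|h1] := pure Cs; have := h1 x u xC uh; rewrite ?ux ?xu.
Qed.

(** If [h = 2], the two uncovered vertices form a digon and [few_missed] makes [u] adjacent to every
    covered vertex, contrary to [stuck_nfull]. *)
Lemma size_hs_gt2 : 2 < h.
Proof.
rewrite ltn_neqAle size_hs_gt1 andbT; apply/eqP => h2.
have [u uh] := hs_nonempty.
have [x [xu nux nxu]] := stuck_nfull st uh.
have := few_missed uh; have := deg_hs uh; have := od_lt uh; have := ind_lt uh; rewrite -h2.
move=> a1 a2 a3 a4.
have m0 : count (fun x => ~~ r u x && ~~ r x u) F = 0 by move: a1 a2 a3 a4; clear; lia.
have /orP[xF|xh] := mem_part x.
  have : has (fun x => ~~ r u x && ~~ r x u) F by apply/hasP; exists x; rewrite // nux.
  by rewrite has_count m0.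
have : od r u hs = 1 by move: a1 a2 a3 a4; clear; lia.
move/eqP; rewrite eqn_leq => /andP[_]; rewrite /od -has_count => /hasP[y yh uy].
have yu : y != u by apply: contraTneq uy => ->; rewrite irr.
have yx : y != x by apply: contraTneq uy => ->.
have : size [:: u; x; y] <= h.
  apply: uniq_leq_size; first by rewrite /= !inE negb_or eq_sym xu eq_sym yu eq_sym yx.
  by move=> z; rewrite !inE => /or3P[] /eqP->.
by rewrite -h2.
Qed.

(** Otherwise the Ore inequality forces an arc from [hs] to every covered vertex, so by [pure] no
    arc leads from a cycle to [hs]. Then a covered vertex and [u] have too small a degree sum. *)
Lemma exists_out u : u \in hs -> exists C x, [/\ C \in s, x \in C & r u x].
Proof.
move=> uh; apply: NNPP => nex.
have nux x : x \in F -> ~~ r u x.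
  by case/flattenP=> C Cs xC; apply/negP => ux; apply: nex; exists C, x.
have z1 : od r u F = 0 by apply: count0.
have l2 := od_lt uh; have l4 := ind_lt uh.
have into x : x \in F -> exists2 w, w \in hs & r w x.
  move=> xF; have ux : u != x by rewrite eq_sym; apply: F_neq_hs uh.
  have := ore_part ux (nux x xF); have l3 := ind_lt xF.
  move=> O; have : 0 < ind r x hs by move: O z1 l2 l3; clear; lia.
  by rewrite /ind -has_count => /hasP[w wh wx]; exists w.
have nout C x w : C \in s -> x \in C -> w \in hs -> ~~ r x w.
  move=> Cs xC wh; have [|h1] := pure Cs; first exact.
  have [v vh vx] := into x (mem_cycle Cs xC).
  by have := h1 x v xC vh; rewrite vx.
have z2 : ind r u F = 0.
  by apply: count0 => x /flattenP[C Cs xC]; apply: nout uh; [exact: Cs|].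
have [C Cs] : exists C, C \in s.
  by case: (s) (stuck_s st) => // C l _; exists C; apply: mem_head.
have [x xC] : exists x, x \in C.
  by case: C Cs (cycle_size Cs) => // x l _ _; exists x; apply: mem_head.
have xF := mem_cycle Cs xC.
have := ore_part (F_neq_hs xF uh) (nout C x u Cs xC uh).
have z3 : od r x hs = 0 by apply: count0 => w; apply: nout Cs xC.
by have := od_lt xF; move: z2 z3 l4; clear; lia.
Qed.

Lemma in_family u v : size F < ind r u F + od r v F ->
  exists2 D, D \in s & size D < ind r u D + od r v D.
Proof.
move=> lt; apply: NNPP => nex; move: lt; rewrite ltnNge => /negP[].
apply: iod_bound => D Ds; rewrite leqNgt; apply/negP => h1; apply: nex; by exists D.
Qed.

Definition no_exit C := forall c w, c \in C -> w \in hs -> ~~ r c w.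

(** A detour back to [u]: since [e] has no arc to [hs], the Ore inequality for [e] and [u] yields a
    cycle that can be entered from [e] just after the vertex from which it is left towards [u]. *)
Lemma bridge C e u : C \in s -> e \in C -> no_exit C -> u \in hs ->
  exists D y, [/\ D \in s, D != C, y \in D, r y u & r e (next D y)].
Proof.
move=> Cs eC nC uh; have eF := mem_cycle Cs eC.
have O := ore_part (F_neq_hs eF uh) (nC e u eC uh).
have z1 : od r e hs = 0 by apply: count0 => w; apply: nC.
have [|D Ds /insertion_point] := @in_family u e.
  by have := ind_lt uh; move: O z1; clear; lia.
case/(_ (cycle_uniq Ds)) => y [yD yu ey]; exists D, y; split=> //.
by apply: contraTneq yu => DC; apply: nC; rewrite // -DC.
Qed.

Lemma segment C a : C \in s -> a \in C -> exists t i,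
  [/\ rot i C = next C a :: t, perm_eq C (next C a :: t), path r (next C a) t
    & last (next C a) t = a].
Proof.
move=> Cs aC; have [t [i e] pe] := rot_next (cycle_uniq Cs) aC (ltnW (cycle_size Cs)).
exists (rcons t a), i; rewrite last_rcons; split=> //.
have : cycle r (rot i C) by rewrite rot_cycle; apply/dcyc_cycle/cycle_dcyc.
by rewrite e /= rcons_path => /andP[].
Qed.

Lemma entered_no_exit C x u : C \in s -> x \in C -> u \in hs -> r u x -> no_exit C.
Proof.
move=> Cs xC uh ux; have [//|h1] := pure Cs.
by have := h1 x u xC uh; rewrite ux.
Qed.

(** If [u] were off [D], one cycle could run through [u], all of [C] and all of [E] by [bridge], and
    [D] would serve as the second. *)
Lemma cycle_hs_spans u D : u \in hs -> dcyc r D -> {subset D <= hs} -> u \in D.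
Proof.
move=> uh dD Dh; apply: contraT => uD.
have [C [x [Cs xC ux]]] := exists_out uh.
have nC := entered_no_exit Cs xC uh ux.
have aC : prev C x \in C by rewrite mem_prev.
have [E [y [Es EC yE yu ey]]] := bridge Cs aC nC uh.
have [t [i [_ peC ptC lC]]] := segment Cs aC.
have [t' [j [_ peE ptE lE]]] := segment Es yE.
rewrite next_prev ?cycle_uniq // in peC ptC lC.
have cM : cycle r ((u :: x :: t) ++ (next E y :: t')).
  by apply: cycle_close => //=; rewrite ?ux ?lC ?lE.
suff : u :: D = [::] by [].
apply: (improve2 Cs Es EC cM (dcyc_cycle dD)) => //.
- by rewrite size_cat /= !addnS.
- by case/and3P: dD.
- apply/permP => a; have := permP peC a; have := permP peE a.
  by rewrite !count_cat /= => -> ->; clear; lia.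
- by rewrite /= uD; apply: dcyc_uniq dD.
- by move=> z; rewrite inE => /orP[/eqP->|/Dh].
Qed.

Lemma size_hs_le4 : h <= 4.
Proof.
rewrite leqNgt; apply/negP => h5.
have [u uh] := hs_nonempty.
have [D [dD Dh]] := hs_cycle1 uh h5.
by rewrite (cycle_hs_spans uh dD Dh).
Qed.

Lemma hs_spanning_cycle : exists D, dcyc r D /\ perm_eq D hs.
Proof.
have [||D [dD Dh _]] := @hs_cycle set0.
- by rewrite setD0 cardsE (card_uniqP hs_uniq) size_hs_gt2.
- by rewrite cards0 size_hs_gt2.
exists D; split=> //; apply: uniq_perm; [exact: dcyc_uniq dD | exact: hs_uniq |].
by move=> x; apply/idP/idP => [/Dh //|xh]; apply: cycle_hs_spans.
Qed.

(** The two arcs would join [C] and [D] into one cycle, and the cycle spanning [hs] would replace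
    the lost one. *)
Lemma no_merge C D a y : C \in s -> D \in s -> D != C -> a \in C -> y \in D ->
  r a (next D y) -> ~~ r y (next C a).
Proof.
move=> Cs Ds DC aC yD ay; apply/negP => ya.
have [t [i [_ peC ptC lC]]] := segment Cs aC.
have [t' [j [_ peD ptD lD]]] := segment Ds yD.
have cM : cycle r ((next C a :: t) ++ (next D y :: t')).
  by apply: cycle_close; rewrite ?lC ?lD.
have [E [dE pE]] := hs_spanning_cycle.
have : E = [::].
  apply: (improve2 Cs Ds DC cM (dcyc_cycle dE)) => //.
  - by rewrite size_cat -(perm_size peC); apply: leq_trans (cycle_size Cs) (leq_addr _ _).
  - by case/and3P: dE.
  - apply/permP => b; have := permP peC b; have := permP peD b.
    by rewrite !count_cat /= => -> ->; clear; lia.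
  - exact: dcyc_uniq dE.
  - by move=> z; rewrite (perm_mem pE).
by move=> E0; case/and3P: dE; rewrite E0.
Qed.

Lemma next_split (p1 p2 : seq V) z y : uniq (p1 ++ z :: y :: p2) ->
  next (p1 ++ z :: y :: p2) z = y.
Proof. by move=> up; rewrite -(next_rot (size p1) up) rot_size_cat /= eqxx. Qed.

(* Otherwise the arc of [C] from [z] to [a] closes to a cycle, and the rest of [C]
   goes into a cycle through [u] and a second member of the family. *)
Lemma chord C a z u : C \in s -> a \in C -> z \in C -> u \in hs ->
  r u (next C a) -> r a z -> z = next C a \/ next C z = a.
Proof.
move=> Cs aC zC uh ua az; apply: NNPP => /not_or_and[zn nz].
have nC : no_exit C by apply: entered_no_exit uh ua; rewrite ?mem_next.
have [t [i [e peC ptC lC]]] := segment Cs aC.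
have ut : uniq (next C a :: t) by rewrite -e rot_uniq cycle_uniq.
have zt : z \in t by have := zC; rewrite (perm_mem peC) inE => /orP[/eqP|].
case/splitPr: zt e peC ptC lC ut => t1 t2 e peC ptC lC ut.
(* This keeps [z :: t2] from being a digon. *)
have s2 : 1 < size t2.
  case: t2 => [|b [|//]] in e peC ptC lC ut *; rewrite last_cat /= in lC.
    by move: az; rewrite lC irr.
  case: nz; rewrite -(next_rot i (cycle_uniq Cs)) e -cat_cons next_split //.
rewrite last_cat /= in lC; move: ptC; rewrite cat_path /= => /and3P[pt1 _ pt2].
set w := last (next C a) t1 in pt1 *.
have wC : w \in C.
  by rewrite (perm_mem peC) -cat_cons mem_cat mem_last.
have [E [y [Es EC yE yu ey]]] := bridge Cs wC nC uh.
have [t' [j [_ peE ptE lE]]] := segment Es yE.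
have cM : cycle r ((u :: next C a :: t1) ++ (next E y :: t')).
  by apply: cycle_close => //=; rewrite ?ua ?lE.
have c2 : cycle r (z :: t2) by rewrite /= rcons_path pt2 lC.
suff : [:: u] = [::] by [].
apply: (improve2 Cs Es EC c2 cM) => //.
- by rewrite size_cat /= !addnS.
- apply/permP => b; have := permP peC b; have := permP peE b.
  rewrite !(count_cat, cat_cons) /= !count_cat /= => -> ->.
  by clear; lia.
- by move=> x; rewrite inE => /eqP->.
Qed.
End Stuck.

Lemma chord_conv (V : finType) (r : rel V) (s : seq (seq V)) (hs C : seq V) b z u : irreflexive r -> ore r ->
  stuck r s hs -> C \in s -> b \in C -> z \in C -> u \in hs ->
  r (prev C b) u -> r z b -> z = prev C b \/ prev C z = b.
Proof.
move=> irr W st Cs bC zC uh bu zb; have uC := cycle_uniq st Cs.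
rewrite -!(next_rev uC).
apply: (@chord _ (conv r) irr (ore_conv W) _ _ (stuck_conv st) (rev C) b z u) => //.
- exact: map_f.
- by rewrite mem_rev.
- by rewrite mem_rev.
- by rewrite next_rev.
Qed.

Lemma count_le_size (T : eqType) (a : pred T) (C l : seq T) : uniq C ->
  (forall z, z \in C -> a z -> z \in l) -> count a C <= size l.
Proof.
move=> uC sub; rewrite -size_filter; apply: uniq_leq_size; first exact: filter_uniq.
by move=> z; rewrite mem_filter => /andP[az zC]; apply: sub.
Qed.

(* For [u -> x], [a = prev B x], [a -> b] and [y = prev D b -> u], the Ore inequalities
   for the pairs [a, u], [u, b] and [y, x] add up to a contradiction. *)
Lemma no_long_cycle (V : finType) (r : rel V) (s : seq (seq V)) (hs B : seq V) : irreflexive r -> ore r ->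
  stuck r s hs -> B \in s -> no_exit r hs B -> 10 <= size B -> False.
Proof.
move=> irr W st Bs nB big.
have uB := cycle_uniq st Bs.
have h4 := size_hs_le4 irr W st.
have [u uh] := hs_nonempty st.
have lo := od_lt irr uh; have li := ind_lt irr uh.
(* At most [h - 2] vertices of [B], hence at most 2, receive no arc from [u]. *)
have mB : count (fun x => ~~ r u x) B <= size hs - 2.
  have := few_missed irr W st uh; rewrite (permP (perm1 Bs)) count_cat.
  have -> : count (fun x => ~~ r u x && ~~ r x u) B = count (fun x => ~~ r u x) B.
    by apply: eq_in_count => x xB; rewrite /= (nB x u xB uh) ?andbT.
  by move: lo li; clear; lia.
have [x xB ux] : exists2 x, x \in B & r u x.
  have : has (r u) B.
    have e : count (r u) B + count (fun x => ~~ r u x) B = size B := count_predC (r u) B.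
    by rewrite has_count; move: e mB big h4; clear; lia.
  by case/hasP => x; exists x.
pose a := prev B x; have aB : a \in B by rewrite mem_prev.
have xa : next B a = x by rewrite next_prev.
have [D [y [Ds DB yD yu ay]]] := bridge irr W st Bs aB nB uh.
have uD := cycle_uniq st Ds.
pose b := next D y; have bD : b \in D by rewrite mem_next.
have nyx : ~~ r y x by rewrite -xa; apply: (no_merge irr W st Bs Ds DB aB yD).
have noD c w : c \in D -> w \in hs -> ~~ r w c.
  have [h1|h1] := pure irr W st Ds; last exact: h1.
  by have := h1 y u yD uh; rewrite yu.
have oaB : od r a B <= 2.
  apply: (@count_le_size _ _ _ [:: x; prev B a]) => // z zB az.
  have [] := @chord _ _ irr W _ _ st B a z u Bs aB zB uh _ az; rewrite ?xa //.
    by move->; rewrite mem_head.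
  by move=> <-; rewrite prev_next // !inE eqxx orbT.
(* By [chord], an in-neighbour [z] of [x] whose successor receives an arc from [u] is [a] or the
   successor of [x]; at most two other [z] remain. *)
have ixB : ind r x B <= 4.
  have le1 : ind r x B <= count (mem [:: a; next B x]) B + count (fun z => ~~ r u (next B z)) B.
    rewrite -count_predUI /ind; apply: leq_trans (leq_addr _ _).
    rewrite (@eq_in_count _ (r^~ x) (fun z => (z \in B) && r z x)) => [|z /= -> //].
    apply: sub_count => z /= /andP[zB zx]; rewrite -[z \in _ _]/(z \in [:: a; next B x]) orbC; have [uz|//] := boolP (r u (next B z)).
    have [e|e] := chord irr W st Bs zB xB uh uz zx.
      by rewrite /a e prev_next // !inE eqxx.
    by rewrite -e !inE eqxx orbT.
  have le2 : count (mem [:: a; next B x]) B <= 2.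
    by apply: (@count_le_size _ _ _ [:: a; next B x]).
  have e3 : count (fun z => ~~ r u (next B z)) B = count (fun x => ~~ r u x) B.
    rewrite -[RHS](permP (perm_map_next uB)) count_map; exact: eq_count.
  by rewrite -e3 in mB; move: le1 le2 mB h4; clear; lia.
have ibD : ind r b D <= 2.
  apply: (@count_le_size _ _ _ [:: y; next D b]) => // z zD zb.
  have [] := chord_conv irr W st Ds bD zD uh _ zb; rewrite ?prev_next //.
    by move->; rewrite mem_head.
  by move=> <-; rewrite next_prev // !inE eqxx orbT.
have oyD := od_lt irr yD.
have rest1 : ind r x (flatten (rem B s)) + od r a (flatten (rem B s)) <= size (flatten (rem B s)).
  apply: iod_bound => E Er; have [Es EB] := rem_neq st Bs Er.
  rewrite leqNgt; apply/negP => /(insertion_point (cycle_uniq st Es))[y' [y'E y'x ay']].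
  by have := no_merge irr W st Bs Es EB aB y'E ay'; rewrite xa y'x.
have rest2 : ind r b (flatten (rem D s)) + od r y (flatten (rem D s)) <= size (flatten (rem D s)).
  apply: iod_bound => E Er; have [Es ED] := rem_neq st Ds Er.
  rewrite leqNgt; apply/negP => /(insertion_point (cycle_uniq st Es))[y' [y'E y'b yy']].
  by have := no_merge irr W st Ds Es ED yD y'E yy'; rewrite y'b.
have aF := mem_cycle Bs aB; have bF := mem_cycle Ds bD.
have xF := mem_cycle Bs xB; have yF := mem_cycle Ds yD.
have O1 := ore_part W st (F_neq_hs st aF uh) (nB a u aB uh).
have ub : u != b by rewrite eq_sym (F_neq_hs st bF uh).
have O2 := ore_part W st ub (noD b u bD uh).
have yx : y != x.
  by apply/eqP => e; move: (nB x u xB uh); rewrite -e yu.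
have O3 := ore_part W st yx nyx.
have z1 : od r a hs = 0 by apply: count0 => w; apply: nB.
have z2 : ind r b hs = 0 by apply: count0 => w wh; apply: noD.
have z3 : ind r x hs <= size hs by apply: count_size.
have z4 : od r y hs <= size hs by apply: count_size.
have z5 := no_insert_all st (hpath1 r uh).
have S1 := split_part r Bs x a; have S2 := split_part r Ds b y.
have sB := size_part Bs; have sD := size_part Ds.
(* The sum of [O1], [O2] and [O3] reduces to [size B <= h + 5], at most 9. *)
move: big h4 lo li oaB ixB ibD oyD rest1 rest2 O1 O2 O3 z1 z2 z3 z4 z5 S1 S2 sB sD; clear.
by lia.
Qed.

(** If all cycles had length at most 9, there would be at most [9k + 4] vertices, fewer than
    [12k + 3]. *)
Lemma not_stuck (V : finType) (r : rel V) s hs : irreflexive r -> ore r ->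
  12 * size s + 3 <= #|V| -> ~ stuck r s hs.
Proof.
move=> irr W large st.
have h4 := size_hs_le4 irr W st.
have [B Bs big] : exists2 B, B \in s & 10 <= size B.
  apply: NNPP => nex; have : size (flatten s) <= 9 * size s.
    have le9 B : B \in s -> size B <= 9.
      by move=> Bs; rewrite leqNgt; apply/negP => h; apply: nex; exists B.
    elim: (s) le9 => //= C l IH le9; rewrite size_cat mulnS; apply: leq_add.
      exact: le9 (mem_head _ _).
    by apply: IH => D Dl; apply: le9; rewrite inE Dl orbT.
  have := card_part st; have := stuck_s st.
  by move: large h4; clear; lia.
have [nB|nB] := pure irr W st Bs; first exact: (no_long_cycle irr W st Bs nB big).
apply: (@no_long_cycle V (conv r) (map rev s) hs (rev B)) => //.
- exact: ore_conv.
- exact: stuck_conv.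
- exact: map_f.
- by move=> c w; rewrite mem_rev; apply: nB.
- by rewrite size_rev.
Qed.

Lemma cycle_partition (V : finType) (r : rel V) k :
  irreflexive r -> ore r -> 0 < k -> 12 * k + 3 <= #|V| ->
  exists s, [/\ size s = k, all (dcyc r) s, uniq (flatten s) & forall v, v \in flatten s].
Proof.
move=> irr W k0 large.
pose low := [set v | #|outs r v| + #|ins r v| < #|V|].
pose full := [set v | [forall u, (u != v) ==> r v u || r u v]].
(* For two nonadjacent vertices the Ore inequalities in both directions add up to degree sum at
   least [2 #|V|], so they are not both in [low]. *)
have sc : semicomplete r (low :|: full).
  move=> x y; rewrite in_setU => /orP[xlow|]; last first.
    by rewrite inE => /forallP/(_ y) h _ xy; rewrite eq_sym xy in h.
  rewrite in_setU => /orP[ylow|]; last first.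
    by rewrite inE => /forallP/(_ x) h xy; rewrite xy orbC in h.
  move=> xy; apply: contraT; rewrite negb_or => /andP[nxy nyx].
  have yx : y != x by rewrite eq_sym.
  move: xlow ylow; rewrite !inE; have := W _ _ xy nxy; have := W _ _ yx nyx.
  by clear; lia.
have [s0 [z0 d0 u0 L0]] := cover_semicomplete irr W sc k0 large.
pose P s := [/\ size s = k, all (dcyc r) s, uniq (flatten s) & {subset low :|: full <= flatten s}].
have [||s [sz dc us Ls] maxs] := @ex_max_measure _ P (fun s => size (flatten s)) #|V| s0.
- by split.
- by move=> s [_ _ us _]; apply: size_uniq_le.
exists s; split=> // v; apply: contraT => vs.
pose hs := [seq x <- enum V | x \notin flatten s].
have mhs x : (x \in hs) = (x \notin flatten s) by rewrite mem_filter mem_enum andbT.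
have uhs : uniq hs by rewrite filter_uniq ?enum_uniq.
have nL x : x \in hs -> x \notin low :|: full by rewrite mhs; apply: contra; apply: Ls.
case: (@not_stuck V r s hs irr W); first by rewrite sz.
split=> //.
- apply: uniq_perm; rewrite ?enum_uniq //.
    by rewrite cat_uniq us uhs andbT; apply/hasPn => x; rewrite mhs.
  by move=> x; rewrite mem_cat mhs mem_enum orbN.
- move=> s' ex dc' sz' pe uex sub.
  have Ps' : P s'.
    split=> //; first by rewrite sz'.
      rewrite (perm_uniq pe) cat_uniq us uex andbT; apply/hasPn => x /sub.
      by rewrite mhs.
    by move=> x /Ls xs; rewrite (perm_mem pe) mem_cat xs.
  have := maxs s' Ps'; rewrite (perm_size pe) size_cat -{2}[size (flatten s)]addn0 leq_add2l.
  by rewrite leqn0 size_eq0 => /eqP.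
- move=> x /nL; rewrite in_setU negb_or => /andP[]; rewrite inE -leqNgt => h _.
  by rewrite /od /ind -!card_set_count.
- move=> x /nL; rewrite in_setU negb_or => /andP[_]; rewrite inE negb_forall => /existsP[u].
  by rewrite negb_imply negb_or => /and3P[]; exists u.
- by rewrite -has_predT; apply/hasP; exists v; rewrite ?mhs.
- by rewrite sz.
Qed.

(** * Contraction of the matching *)

Lemma set2_other (T : finType) (a b c : T) : a != b -> [set a; b] = [set a; c] -> b = c.
Proof.
move=> ab e; have : b \in [set a; c] by rewrite -e !inE eqxx orbT.
by rewrite !inE eq_sym (negPf ab) => /eqP.
Qed.

Lemma uniq_of_flatten (T : eqType) (s : seq (seq T)) :
  (forall c, c \in s -> c != [::]) -> uniq (flatten s) -> uniq s.
Proof.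
elim: s => //= c s IH ne; rewrite cat_uniq => /and3P[_ /hasPn disj us].
rewrite IH ?us ?andbT // => [|d ds]; last by apply: ne; rewrite inE ds orbT.
apply/negP => cs; case: c ne disj cs => [/(_ _ (mem_head _ _)) //|x c] _ disj cs.
have xs : x \in flatten s by apply/flattenP; exists (x :: c); rewrite ?mem_head.
by have := disj x xs; rewrite /= mem_head.
Qed.

Section Matching.
Variables (T : finType) (e : rel T) (X : {set T}) (M : {set {set T}}).
Hypothesis sg : simple_graph e.
Hypothesis bip : bipartite_with e X.
Hypothesis pm : perfect_matching e M.

Lemma edge_neq x y : e x y -> x != y.
Proof. by case: sg => _ irr; apply: contraTneq => ->; rewrite irr. Qed.

Lemma mem_edges x y : e x y -> [set x; y] \in edges e.
Proof. by move=> exy; apply/imset2P; exists x y; rewrite ?inE. Qed.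

Lemma edgesP x y : [set x; y] \in edges e -> e x y.
Proof.
case: sg => sym irr /imset2P[a b _]; rewrite inE => /andP[_ eab] E.
have ab := edge_neq eab.
have ha : a \in [set x; y] by rewrite E !inE eqxx.
have hb : b \in [set x; y] by rewrite E !inE eqxx orbT.
rewrite !inE in ha hb; move: eab ab.
by case/orP: ha => /eqP->; case/orP: hb => /eqP->; rewrite ?eqxx // sym.
Qed.

Lemma matched x y : [set x; y] \in M -> e x y.
Proof. by case: pm => /subsetP sub _ /sub; apply: edgesP. Qed.

(** The default is never reached, by [mateP]. *)
Definition mate x := odflt x [pick y | [set x; y] \in M].

Lemma mateP x : [set x; mate x] \in M.
Proof.
rewrite /mate; case: pickP => [y //|none].
have : 0 < edeg M x by case: pm => _ ->.
case/card_gt0P => f; rewrite inE => /andP[fM xf].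
have /imset2P[a b _ _ E] : f \in edges e by case: pm => /subsetP sub _; apply: sub.
move: xf fM; rewrite E !inE => /orP[]/eqP<- fM; first by have := none b; rewrite fM.
by have := none a; rewrite setUC fM.
Qed.

Lemma mate_edge x : e x (mate x). Proof. exact: matched (mateP x). Qed.

Lemma matching_inj x f g : f \in M -> g \in M -> x \in f -> x \in g -> f = g.
Proof.
move=> fM gM xf xg; have /eqP/cards1P[h eh] : edeg M x = 1 by case: pm.
have : f \in [set h] by rewrite -eh inE fM.
have : g \in [set h] by rewrite -eh inE gM.
by rewrite !inE => /eqP-> /eqP->.
Qed.

Lemma mate_unique x y : [set x; y] \in M -> y = mate x.
Proof.
move=> xyM; apply: (set2_other (edge_neq (matched xyM))).
by apply: (matching_inj (x := x)); rewrite ?mateP // !inE eqxx.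
Qed.

Lemma mateK : involutive mate.
Proof. by move=> x; apply/esym/mate_unique; rewrite setUC mateP. Qed.

Lemma mate_side x : (mate x \in X) = (x \notin X).
Proof. by have := bip (mate_edge x); case: (x \in X); case: (mate x \in X). Qed.

Let V : finType := {x : T | x \in X}.

(** Without [u != v] every matching edge would be a loop. *)
Definition contract : rel V := fun u v => (u != v) && e (val u) (mate (val v)).

Lemma contract_irr : irreflexive contract.
Proof. by move=> u; rewrite /contract eqxx. Qed.

Lemma card_contract : #|V| = #|X|. Proof. by rewrite card_sig. Qed.

(** Each of the two degrees loses exactly its matching edge, which accounts for the 2. *)
Lemma contract_ore : sigma11_ge e X (#|X| + 2) -> ore contract.
Proof.
case: (sg) => sym _ sig u v uv nuv.
have nX : mate (val v) \notin X by rewrite mate_side negbK (valP v).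
have ne : ~~ e (val u) (mate (val v)) by move: nuv; rewrite /contract uv.
have le1 : deg e (val u) <= #|outs contract u| + 1.
  apply: leq_trans (_ : #|[set mate (val w) | w in u |: outs contract u]| <= _).
    apply/subset_leq_card/subsetP => y; rewrite inE => uy.
    have yX : mate y \in X by rewrite mate_side; have := bip uy; rewrite (valP u).
    apply/imsetP; exists (Sub (mate y) yX); last by rewrite SubK mateK.
    rewrite !inE; case: eqVneq => //= ne'.
    by rewrite /contract eq_sym ne' SubK mateK.
  apply: leq_trans (leq_imset_card _ _) _; rewrite cardsU1 addnC leq_add2l.
  by case: (_ \notin _).
have le2 : deg e (mate (val v)) <= #|ins contract v| + 1.
  apply: leq_trans (_ : #|[set val w | w in v |: ins contract v]| <= _).
    apply/subset_leq_card/subsetP => y; rewrite inE => vy.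
    have yX : y \in X by have := bip vy; rewrite mate_side (valP v); case: (y \in X).
    apply/imsetP; exists (Sub y yX); last by rewrite SubK.
    rewrite !inE; case: eqVneq => //= ne'.
    by rewrite /contract ne' SubK sym.
  apply: leq_trans (leq_imset_card _ _) _; rewrite cardsU1 addnC leq_add2l.
  by case: (_ \notin _).
rewrite card_contract; have := sig _ _ (valP u) nX ne.
by move: le1 le2; clear; lia.
Qed.

(** * Lifting a partition into cycles to a 2-factor *)

Section Factor.
Variable s : seq (seq V).
Hypothesis dcs : all (dcyc contract) s.
Hypothesis us : uniq (flatten s).
Hypothesis full : forall v, v \in flatten s.

(** The cycle of [s] through [v]; the default is never reached as [s] covers everything. *)
Definition cyc v := nth [::] s (find (fun c => v \in c) s).
Definition succ v := next (cyc v) v.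

Lemma has_cyc v : has (fun c => v \in c) s.
Proof. by have /flattenP[c cs vc] := full v; apply/hasP; exists c. Qed.

Lemma cyc_in v : cyc v \in s.
Proof. by rewrite mem_nth // -has_find has_cyc. Qed.

Lemma mem_cyc v : v \in cyc v.
Proof. exact: (nth_find [::] (has_cyc v)). Qed.

Lemma cyc_eq c v : c \in s -> v \in c -> cyc v = c.
Proof.
move=> cs vc; apply/eqP; apply: contraT => ne.
have u2 := us; rewrite (perm_uniq (perm_flatten (perm_to_rem cs))) /= cat_uniq in u2.
case/and3P: u2 => _ /hasPn h _; have vr : v \in flatten (rem c s).
  apply/flattenP; exists (cyc v); last exact: mem_cyc.
  by have := cyc_in v; rewrite (perm_mem (perm_to_rem cs)) inE (negPf ne).
by have := h v vr; rewrite /= vc.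
Qed.

Lemma cyc_dcyc v : dcyc contract (cyc v).
Proof. exact: (allP dcs) (cyc_in v). Qed.

Lemma cyc_uniq v : uniq (cyc v). Proof. exact: dcyc_uniq (cyc_dcyc v). Qed.

Lemma succ_cyc v : cyc (succ v) = cyc v.
Proof. by apply: cyc_eq; rewrite ?cyc_in // mem_next mem_cyc. Qed.

Lemma succ_inj : injective succ.
Proof.
move=> u v E; have Ec : cyc u = cyc v by rewrite -succ_cyc E succ_cyc.
by move: E; rewrite /succ Ec; apply: can_inj (prev_next (cyc_uniq v)) _ _.
Qed.

Lemma succ_arc v : contract v (succ v).
Proof. by apply: next_cycle; [case/and3P: (cyc_dcyc v) | apply: mem_cyc]. Qed.

Lemma succ_neq v : succ v != v.
Proof. by apply: contraTneq (succ_arc v) => E; rewrite E contract_irr. Qed.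

(** The edge of the graph that the arc from [v] to [succ v] stands for. *)
Definition link v := [set val v; mate (val (succ v))].
Definition factor := M :|: [set link v | v in [set: V]].

Lemma link_in v : link v \in factor.
Proof. by rewrite inE; apply/orP; right; apply: imset_f. Qed.

Lemma mate_in x : [set x; mate x] \in factor.
Proof. by rewrite inE mateP. Qed.

Lemma mem_link x v : (x \in link v) = if x \in X then x == val v else x == mate (val (succ v)).
Proof.
rewrite !inE; have [xX|xX] := boolP (x \in X).
  rewrite orbC; case: eqP => // E; move: xX; rewrite E mate_side (valP (succ v)).
  by [].
by case: eqP => // E; rewrite E (valP v) in xX.
Qed.

(** Besides its matching edge, a vertex of [X] lies on its own link, and a vertex outside [X] on the
    link of the predecessor of its mate. The two edges differ because [succ] has no fixed point. *)
Lemma edeg_factor x : edeg factor x = 2.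
Proof.
have [w wx] : exists w, x \in link w.
  have [xX|xX] := boolP (x \in X).
    by exists (Sub x xX); rewrite mem_link xX SubK.
  have yX : mate x \in X by rewrite mate_side.
  have [w ew] : exists w, succ w = Sub (mate x) yX.
    by exists (invF succ_inj (Sub (mate x) yX)); rewrite f_invF.
  by exists w; rewrite mem_link (negPf xX) ew SubK mateK.
have -> : edeg factor x = #|[set [set x; mate x]; link w]|.
  apply: eq_card => f; rewrite !inE; apply/andP/orP => [[/orP[fM|]]|].
  - by move=> xf; left; apply/eqP; apply: (matching_inj (x := x)); rewrite ?mateP // !inE eqxx.
  - case/imsetP => v _ -> xv; right; apply/eqP; congr link.
    move: xv wx; rewrite !mem_link; case: ifP => _ /eqP-> /eqP; first exact: val_inj.
    by move/(can_inj mateK)/val_inj/succ_inj.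
  - case=> /eqP->; first by rewrite mateP !inE eqxx.
    by split=> //; apply/orP; right; apply: imset_f.
rewrite cards2; case: eqP => // E; exfalso.
have wl : val w \in [set x; mate x] by rewrite E !inE eqxx.
have sl : mate (val (succ w)) \in [set x; mate x] by rewrite E !inE eqxx orbT.
have : [set val w; mate (val (succ w))] \in M by rewrite -/(link w) -E mateP.
move/mate_unique/(can_inj mateK)/val_inj/eqP; exact/negP/succ_neq.
Qed.

Lemma factor_edges : factor \subset edges e.
Proof.
rewrite subUset; case: pm => -> _ /=; apply/subsetP => f /imsetP[v _ ->].
by apply: mem_edges; case/andP: (succ_arc v).
Qed.


Lemma base_ex x : exists v : V, val v == if x \in X then x else mate x.
Proof.
have yX : (if x \in X then x else mate x) \in X by case: ifP => //; rewrite mate_side => ->.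
by exists (exist (fun z => z \in X) _ yX) => /=.
Qed.

(** The contraction map from the graph to the digraph. *)
Definition base x := xchoose (base_ex x).

Lemma val_base x : val (base x) = if x \in X then x else mate x.
Proof. exact/eqP/(xchooseP (base_ex x)). Qed.

Lemma base_val v : base (val v) = v.
Proof. by apply: val_inj; rewrite val_base (valP v). Qed.

Lemma base_mate x : base (mate x) = base x.
Proof. by apply: val_inj; rewrite !val_base mate_side mateK; case: (x \in X). Qed.

Lemma cyc_link x v : x \in link v -> cyc (base x) = cyc v.
Proof.
rewrite mem_link; case: ifP => _ /eqP->; first by rewrite base_val.
by rewrite base_mate base_val succ_cyc.
Qed.

Lemma frel_cyc x y : Defs.frel factor x y -> cyc (base x) = cyc (base y).
Proof.
rewrite /Defs.frel inE => /orP[/mate_unique->|/imsetP[v _ E]]; first by rewrite base_mate.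
by rewrite !(@cyc_link _ v) -?E ?inE ?eqxx ?orbT.
Qed.

Lemma frel_sym : connect_sym (Defs.frel factor).
Proof. by apply: sym_connect_sym => x y; rewrite /Defs.frel setUC. Qed.

Lemma connect_base x : connect (Defs.frel factor) x (val (base x)).
Proof.
rewrite val_base; case: ifP => _; first exact: connect0.
by apply: connect1; apply: mate_in.
Qed.

(** An arc of the cycle lifts to a link followed by a matching edge, so walking around the cycle
    connects the lifts. *)
Lemma connect_val u v : cyc u = cyc v -> connect (Defs.frel factor) (val u) (val v).
Proof.
move=> E; pose g : rel V := relpre val (connect (Defs.frel factor)).
have cg : cycle g (cyc u).
  apply: cycle_from_next => [|w wu]; first exact: cyc_uniq.
  have <- : succ w = next (cyc u) w by rewrite /succ (cyc_eq (cyc_in u) wu).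
  apply: (@connect_trans _ _ (mate (val (succ w)))); apply: connect1; first exact: link_in.
  by rewrite /Defs.frel -{2}[val (succ w)]mateK mate_in.
have vu : v \in cyc u by rewrite E mem_cyc.
have /connectP[p + ->] := connect_cycle cg (mem_cyc u) vu.
elim: p u {E cg vu} => [|w p IH] u /=; first by rewrite connect0.
by case/andP=> /connect_trans uw /IH; apply: uw.
Qed.

Lemma fcompE x : fcomp factor x = [set y | cyc (base y) == cyc (base x)].
Proof.
apply/setP => y; rewrite !inE; apply/idP/eqP => [/connectP[p pth ->]|E].
  elim: p x pth => //= z p IH x /andP[xz /IH->].
  by rewrite (frel_cyc xz).
apply: connect_trans (connect_base x) _; rewrite frel_sym.
apply: connect_trans (connect_base y) _; exact: connect_val.
Qed.

(** A component consists of the at least three vertices of a cycle and their mates. *)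
Lemma card_fcomp x : 6 <= #|fcomp factor x|.
Proof.
rewrite fcompE; set c := cyc (base x).
have uc : uniq c := cyc_uniq _; have sc : 2 < size c by case/and3P: (cyc_dcyc (base x)).
pose l := map val c ++ map (fun v : V => mate (val v)) c.
have ul : uniq l.
  rewrite cat_uniq !map_inj_uniq // ?uc ?andbT /=; last 2 first.
  - by move=> a b /(can_inj mateK)/val_inj.
  - exact: val_inj.
  apply/hasPn => y /mapP[v _ ->]; apply/negP => /mapP[w _ E].
  by have wX : sval w \in X := valP w; rewrite -E mate_side (valP v) in wX.
apply: leq_trans (_ : #|l| <= _).
  by rewrite (card_uniqP ul) size_cat !size_map -[6]/(3 + 3) leq_add.
apply/subset_leq_card/subsetP => y; rewrite mem_cat inE => /orP[] /mapP[v vc ->].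
  by rewrite base_val (cyc_eq (cyc_in _) vc).
by rewrite base_mate base_val (cyc_eq (cyc_in _) vc).
Qed.

Lemma ncycles_factor : ncycles factor = size s.
Proof.
pose G c := [set y | cyc (base y) == c].
have G_inj : {in s &, injective G}.
  move=> c d cs ds E; have [v vc] : exists v, v \in c.
    by case: c cs {E} => [/(allP dcs) //|v c _]; exists v; apply: mem_head.
  have : val v \in G d by rewrite -E inE base_val (cyc_eq cs vc).
  by rewrite inE base_val (cyc_eq cs vc) => /eqP.
have us' : uniq s.
  by apply: uniq_of_flatten us => c /(allP dcs); case: c.
have <- : size (map G s) = size s by rewrite size_map.
rewrite -(card_uniqP _) ?map_inj_in_uniq //; apply: eq_card => A.
apply/imsetP/mapP => [[x _ ->]|[c cs ->]].
  by exists (cyc (base x)); rewrite ?cyc_in // fcompE.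
have [v vc] : exists v, v \in c.
  by case: c cs => [/(allP dcs) //|v c _]; exists v; apply: mem_head.
by exists (val v); rewrite // fcompE base_val (cyc_eq cs vc).
Qed.
End Factor.
End Matching.

Theorem theorem2 (T : finType) (e : rel T) (X : {set T}) (M : {set {set T}})
    (k n : nat) :
  0 < k ->
  simple_graph e ->
  bipartite_with e X ->
  #|X| = n -> #|~: X| = n ->
  perfect_matching e M ->
  12 * k + 3 <= n ->
  sigma11_ge e X (n + 2) ->
  exists F : {set {set T}},
    [/\ two_factor e F,
        ncycles F = k,
        (forall x : T, 6 <= #|fcomp F x|)
      & M \subset F].
Proof.
move=> k0 sg bip cX _ pm large sig.
have W : ore (contract e (X := X) M) by apply: contract_ore; rewrite ?cX.
have [|s [sz dc us full]] := cycle_partition (contract_irr e M) W k0; first by rewrite card_contract cX.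
exists (factor M s); split.
- by split; [apply: factor_edges | apply: edeg_factor sg bip pm _ dc us full].
- by rewrite (ncycles_factor sg bip pm dc us full).
- exact: (card_fcomp sg bip pm dc us full).
- exact: subsetUl.
Qed.
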